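(* The following hold. (1) Let $n\neq 4$ be a positive integer and let $K=\mathbb{Q}(\sqrt{1-2^{n+2}})$. Then the prime $2$ splits in $\mathcal{O}_K$ into two distinct prime ideals, and the class of each of them in the ideal class group $\mathrm{Cl}(\mathcal{O}_K)$ has order $n$. (2) Let $K=\mathbb{Q}(\sqrt{-39})$. Then the prime $2$ splits in $\mathcal{O}_K$ into two distinct prime ideals whose classes in $\mathrm{Cl}(\mathcal{O}_K)$ have order $4$. (3) Let $\ell$ be an odd prime and $n$ a positive integer, and set $K_1=\mathbb{Q}(\sqrt{1-\ell^n})$ and $K_2=\mathbb{Q}(\sqrt{1-4\ell^n})$. Then for at least one $i\in\{1,2\}$, the prime $\ell$ splits in $\mathcal{O}_{K_i}$ into two distinct prime ideals whose classes in $\mathrm{Cl}(\mathcal{O}_{K_i})$ have order $n$.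
   Context: $\mathcal{O}_K$ denotes the ring of integers of the number field $K$ and $\mathrm{Cl}(\mathcal{O}_K)$ its ideal class group. *)

(* Defs.v *)
From mathcomp Require Import all_boot all_order all_algebra all_field.
Set Implicit Arguments. Unset Strict Implicit. Unset Printing Implicit Defensive.
Import Order.TTheory GRing.Theory Num.Theory.
Local Open Scope ring_scope.

Definition Qsqrt (d : int) : algC -> Prop :=
  fun x => exists a b : rat, x = ratr a + ratr b * sqrtC (d%:~R).

Definition OK (d : int) : algC -> Prop := fun x => Qsqrt d x /\ x \in Aint.

Definition is_ideal (d : int) (I : algC -> Prop) : Prop :=
  [/\ forall x, I x -> OK d x,
      I 0,
      forall x y, I x -> I y -> I (x + y)
    & forall r x, OK d r -> I x -> I (r * x)].

Definition ideal_eq (I J : algC -> Prop) : Prop := forall x, I x <-> J x.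

Definition pideal (d : int) (a : algC) : algC -> Prop :=
  fun x => exists r, OK d r /\ x = a * r.

Definition is_principal (d : int) (I : algC -> Prop) : Prop :=
  exists a, OK d a /\ ideal_eq I (pideal d a).

Definition ideal_mul (I J : algC -> Prop) : algC -> Prop :=
  fun z => exists s : seq (algC * algC),
    (forall p, p \in s -> I p.1 /\ J p.2) /\ z = \sum_(p <- s) p.1 * p.2.

Fixpoint ideal_pow (d : int) (I : algC -> Prop) (m : nat) : algC -> Prop :=
  match m with
  | 0%N => OK d
  | m'.+1 => ideal_mul I (ideal_pow d I m')
  end.

Definition prime_ideal (d : int) (P : algC -> Prop) : Prop :=
  [/\ is_ideal d P, ~ P 1
    & forall x y, OK d x -> OK d y -> P (x * y) -> P x \/ P y].

(* The class of the (nonzero) ideal I in Cl(O_K) has order n: the least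
   m >= 1 with [I]^m = [I^m] trivial, i.e. I^m principal, is n. *)
Definition class_order (d : int) (I : algC -> Prop) (n : nat) : Prop :=
  [/\ (0 < n)%N, is_principal d (ideal_pow d I n)
    & forall m, (0 < m < n)%N -> ~ is_principal d (ideal_pow d I m)].

Definition splits_with_class_order (d : int) (p n : nat) : Prop :=
  exists P1 P2 : algC -> Prop,
    [/\ prime_ideal d P1, prime_ideal d P2, ~ ideal_eq P1 P2,
        ideal_eq (pideal d p%:R) (ideal_mul P1 P2)
      & class_order d P1 n /\ class_order d P2 n].

(* Main.v *)
Require Import Defs.
From mathcomp Require Import all_boot all_order all_algebra all_field.
From mathcomp Require Import ring zify.
Set Implicit Arguments. Unset Strict Implicit. Unset Printing Implicit Defensive.
Import Order.TTheory GRing.Theory Num.Theory.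
Local Open Scope ring_scope.

(* Put al for an element of norm l^n and trace t prime to l: al = (t + u sqrt d) / 2.
   The ideal P = (l, al) satisfies P^k = (l^k, al) for k <= n, so P^n = (al). If P^k were
   principal with 0 < k < n, then al would be, up to a unit, a p-th power b^p with p a prime
   divisor of n and b of norm l^(n/p); only the trace Tr(b^p) = t or -t is then used.
   For t = 1 and p odd, Tr b divides 1, and expanding (1 - x)^p shows that Tr(b^p) = 1 or -1
   is impossible; p = 2 gives (Tr b)^2 = 2 l^(n/2) + 1 or - 1, which for l = 2 forces n = 4.
   For odd l this square condition is the only obstruction in Q(sqrt(1 - 4 l^n)) and it excludes
   every obstruction in Q(sqrt(1 - l^n)): then n = 2m, 2 b^2 = l^m + 1 or - 1 is incompatible
   with it, and odd p are ruled out 2-adically since l^(n/p) = 1 mod 4. Units other than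
   1 and -1 occur only in Q(i) and Q(sqrt(-3)); the latter needs the case u + v = 1 of Fermat's
   last theorem for exponent 3 (Euler's descent). *)

(** * Quadratic integers *)

(** The conjugate s' has the same square as s; were it s itself, d = s s' would be nonnegative. *)
Lemma sqrtC_intN (d : int) : d < 0 -> (sqrtC (d%:~R : algC))^* = - sqrtC d%:~R.
Proof.
move=> d0; set s := sqrtC _; have s2 : s ^+ 2 = d%:~R by rewrite sqrtCK.
have : (s^*) ^+ 2 == s ^+ 2 by rewrite -rmorphXn /= s2 rmorph_int.
rewrite eqf_sqr => /orP[/eqP sr|/eqP //].
have : 0 <= s * s^* by exact: mul_conjC_ge0.
by rewrite sr -expr2 s2 ler0z leNgt d0.
Qed.

Lemma conjC_Qsqrt (d : int) (a b : rat) : d < 0 ->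
  (ratr a + ratr b * sqrtC d%:~R : algC)^* = ratr a - ratr b * sqrtC d%:~R.
Proof.
move=> d0; rewrite rmorphD [X in _ + X]rmorphM /= sqrtC_intN //.
by rewrite !conj_Crat ?Crat_rat // mulrN.
Qed.

Lemma Qsqrt_conj d x : d < 0 -> Qsqrt d x -> Qsqrt d x^*.
Proof.
move=> d0 [a [b ->]]; exists a, (- b).
by rewrite conjC_Qsqrt // raddfN /= mulNr.
Qed.

Lemma QsqrtD d x y : Qsqrt d x -> Qsqrt d y -> Qsqrt d (x + y).
Proof.
move=> [a [b ->]] [a' [b' ->]]; exists (a + a'), (b + b').
by rewrite !rmorphD /=; ring.
Qed.

Lemma QsqrtM d x y : Qsqrt d x -> Qsqrt d y -> Qsqrt d (x * y).
Proof.
move=> [a [b ->]] [a' [b' ->]]; exists (a * a' + b * b' * d%:~R), (a * b' + b * a').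
rewrite !rmorphD /= !rmorphM /= !ratr_int.
have e : (d%:~R : algC) = sqrtC d%:~R * sqrtC d%:~R by rewrite -expr2 sqrtCK.
by rewrite {3}e; ring.
Qed.

Lemma Qsqrt_rat d (a : rat) : Qsqrt d (ratr a).
Proof. by exists a, 0; rewrite rmorph0 mul0r addr0. Qed.

Lemma OKD d x y : OK d x -> OK d y -> OK d (x + y).
Proof. by move=> [? ?] [? ?]; split; [exact: QsqrtD | exact: rpredD]. Qed.

Lemma OKM d x y : OK d x -> OK d y -> OK d (x * y).
Proof. by move=> [? ?] [? ?]; split; [exact: QsqrtM | exact: rpredM]. Qed.

Lemma OK_int d (c : int) : OK d c%:~R.
Proof. by split; [rewrite -(ratr_int algC); exact: Qsqrt_rat | exact: Aint_int]. Qed.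

Lemma OK_nat d (c : nat) : OK d c%:R.
Proof. exact: (@OK_int d c). Qed.

Lemma OK0 d : OK d 0. Proof. exact: (@OK_int d 0). Qed.
Lemma OK1 d : OK d 1. Proof. exact: (@OK_int d 1). Qed.

Lemma OKN d x : OK d x -> OK d (- x).
Proof. by move=> ?; rewrite -mulN1r; apply: OKM => //; exact: (@OK_int d (- 1)). Qed.

Lemma OKX d x k : OK d x -> OK d (x ^+ k).
Proof.
move=> Ox; elim: k => [|k IH]; rewrite ?expr0 ?exprS; [exact: OK1 | exact: OKM].
Qed.

Lemma OK_conj d x : d < 0 -> OK d x -> OK d x^*.
Proof. by move=> d0 [? ?]; split; [exact: Qsqrt_conj | rewrite Aint_aut]. Qed.

#[local] Hint Resolve OKD OKM OK_int OK_nat OK0 OK1 OKN OKX OK_conj : core.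

Lemma Qsqrt_trace d x : d < 0 -> Qsqrt d x -> x + x^* \in Crat.
Proof.
move=> d0 [a [b ->]].
by rewrite conjC_Qsqrt // addrACA subrr addr0 rpredD ?Crat_rat.
Qed.

Lemma Qsqrt_norm d x : d < 0 -> Qsqrt d x -> x * x^* \in Crat.
Proof.
move=> d0 [a [b ->]].
rewrite conjC_Qsqrt // mulrC -subr_sqr (exprMn _ (ratr b)) sqrtCK.
apply: rpredB; first exact/rpredX/Crat_rat.
by apply: rpredM; [exact/rpredX/Crat_rat | exact: rpred_int].
Qed.

Lemma OK_rat d x : x \in Crat -> OK d x -> exists c : int, x = c%:~R.
Proof. by move=> xQ [_ xA]; apply/intrP; exact: Cint_rat_Aint. Qed.

Lemma OK_trace d x : d < 0 -> OK d x -> exists c : int, x + x^* = c%:~R.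
Proof. by move=> d0 Ox; apply: (@OK_rat d); [apply: (@Qsqrt_trace d) => //; case: Ox | auto]. Qed.

Lemma OK_norm d x : d < 0 -> OK d x -> exists c : int, x * x^* = c%:~R.
Proof. by move=> d0 Ox; apply: (@OK_rat d); [apply: (@Qsqrt_norm d) => //; case: Ox | auto]. Qed.

Lemma Aint_quadratic (x : algC) (t n : int) : x ^+ 2 = t%:~R * x - n%:~R -> x \in Aint.
Proof.
move=> xE; apply: (@root_monic_Aint (('X - t%:~R%:P) * 'X + n%:~R%:P)).
- by rewrite /root !hornerE mulrBl -expr2 xE; apply/eqP; ring.
- rewrite monicE lead_coefE size_MXaddC polyXsubC_eq0 size_XsubC /=.
  by rewrite !coefE /=; apply/eqP; ring.
- apply/polyOverP => -[|[|[|i]]]; rewrite !coefE /=.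
  + by rewrite add0r intr_int.
  + by rewrite sub0r addr0 rpredN intr_int.
  + by rewrite subr0 addr0 rpred1.
  + by rewrite subr0 addr0 rpred0.
Qed.

(** * Powers of a split prime ideal *)

Section Splitting.
Variables (d : int) (l : nat).
Hypotheses (d_lt0 : d < 0) (l_prime : prime l).
Let OKd_conj x : OK d x -> OK d x^* := @OK_conj d x d_lt0.
#[local] Hint Resolve OKd_conj : core.

(** The recurrence Tr(x^(k+2)) = t Tr(x^(k+1)) - n Tr(x^k), read modulo the norm n. *)
Lemma trace_pow x (t n : int) k : OK d x -> x + x^* = t%:~R -> x * x^* = n%:~R ->
  exists f : int, x ^+ k.+1 + x^* ^+ k.+1 = (t ^+ k.+1 + n * f)%:~R.
Proof.
move=> Ox xt xn; elim: k => [|k [f IH]].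
  by exists 0; rewrite mulr0 addr0 !expr1.
have [c cE] := OK_trace d_lt0 (OKX k Ox).
exists (t * f - c).
have -> : t ^+ k.+2 + n * (t * f - c) = t * (t ^+ k.+1 + n * f) - n * c.
  by rewrite exprS; ring.
rewrite [RHS]rmorphB [X in X - _]rmorphM [X in _ - X]rmorphM /= -IH -cE -xt -xn.
by rewrite rmorphXn /= !exprS; ring.
Qed.

Lemma natXz_intr k : ((l%:Z) ^+ k)%:~R = l%:R ^+ k :> algC.
Proof. by rewrite rmorphXn. Qed.

Lemma coprimez_prime (c : int) : ~~ (l %| c)%Z -> coprimez l c.
Proof. by rewrite dvdzE /= => h; rewrite coprimezE /= prime_coprime. Qed.

Lemma dvdz_primeM (a b : int) : (l %| a * b)%Z = (l %| a)%Z || (l %| b)%Z.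
Proof. by rewrite !dvdzE abszM Euclid_dvdM. Qed.

Lemma dvdz_primeX (a : int) k : (l %| a ^+ k.+1)%Z = (l %| a)%Z.
Proof. by elim: k => [|k IH]; rewrite ?expr1 // exprS dvdz_primeM IH orbb. Qed.

Lemma trace_ndvd_mul x w (t : int) :
  x + x^* = t%:~R -> ~~ (l %| t)%Z -> OK d w -> x <> l%:R * w.
Proof.
move=> xt /negP lt Ow xE; apply: lt.
have [c cE] := OK_trace d_lt0 Ow.
apply/dvdzP; exists c; apply: (@intr_inj algC).
by rewrite -xt xE rmorphM rmorph_nat -mulrDr cE [RHS]rmorphM /= mulrC.
Qed.

Lemma trace_pow_ndvd x (t n : int) k : OK d x -> x + x^* = t%:~R ->
  x * x^* = n%:~R -> ~~ (l %| t)%Z -> (l %| n)%Z ->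
  exists2 c : int, x ^+ k.+1 + (x ^+ k.+1)^* = c%:~R & ~~ (l %| c)%Z.
Proof.
move=> Ox xt xn lt ln; have [f fE] := trace_pow k Ox xt xn.
exists (t ^+ k.+1 + n * f); first by rewrite rmorphXn.
by rewrite rpredDr ?dvdz_primeX // dvdz_mulr.
Qed.

(** The quotient x / y is x y' / l^b, whose trace s / l^b and norm l^(a - b) are integers; this
    makes it integral. *)
Lemma trace_mul_conj_dvd x y a b (s : int) : OK d x -> OK d y -> (b <= a)%N ->
  x * x^* = l%:R ^+ a -> y * y^* = l%:R ^+ b ->
  x * y^* + (x * y^*)^* = s%:~R -> ((l%:Z) ^+ b %| s)%Z ->
  exists e, [/\ OK d e, e * e^* = l%:R ^+ (a - b) & x = e * y].
Proof.
move=> Ox Oy ba xa yb xys /dvdzP[c sE].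
have L0 k : (l%:R ^+ k : algC) != 0.
  by rewrite expf_neq0 // pnatr_eq0 -lt0n prime_gt0.
have lC k : (l%:R ^+ k : algC)^* = l%:R ^+ k by rewrite rmorphXn rmorph_nat.
pose z := x * y^*; pose e := z / l%:R ^+ b.
have eC : e^* = z^* / l%:R ^+ b by rewrite rmorphM fmorphV /= lC.
have ee : e * e^* = l%:R ^+ (a - b).
  have zN : z * z^* = l%:R ^+ a * l%:R ^+ b.
    by rewrite /z rmorphM /= conjCK mulrACA xa (mulrC _ y) yb.
  rewrite eC /e mulrACA zN -[in l%:R ^+ a](subnK ba) exprD -invfM -mulrA.
  by rewrite mulfK // mulf_neq0.
have et : e + e^* = c%:~R.
  by rewrite eC -mulrDl xys sE intrM natXz_intr mulfK.
exists e; split => //.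
  split.
    apply: QsqrtM; first by case: (OKM Ox (OKd_conj Oy)).
    have -> : (l%:R ^+ b : algC)^-1 = ratr (l%:R ^+ b)^-1.
      by rewrite fmorphV rmorphXn /= ratr_nat.
    exact: Qsqrt_rat.
  apply: (@Aint_quadratic _ c ((l%:Z) ^+ (a - b))).
  by rewrite -et natXz_intr -ee; ring.
by rewrite /e /z mulrAC -(mulrA x) (mulrC y^*) yb mulfK.
Qed.

(* With s = Tr(x y'), s' = Tr(x y) (' is conjugation), s s' is divisible by l^b while
   s + s' = Tr(x) Tr(y) is prime to l, so l^b divides s or s'. *)
Lemma norm_prime_power_dvd x y a b (s t : int) : OK d x -> OK d y -> (b <= a)%N ->
  x * x^* = l%:R ^+ a -> y * y^* = l%:R ^+ b ->
  x + x^* = s%:~R -> y + y^* = t%:~R -> ~~ (l %| s)%Z -> ~~ (l %| t)%Z ->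
  exists e, [/\ OK d e, e * e^* = l%:R ^+ (a - b) & x = e * y \/ x = e * y^*].
Proof.
move=> Ox Oy ba xa yb xs yt ls lt.
have Oyc := OKd_conj Oy.
have [u uE] := OK_trace d_lt0 (OKM Ox Oyc).
have [v vE] := OK_trace d_lt0 (OKM Ox Oy).
(* Tr(x y') Tr(x y) = y y' Tr(x^2) + x x' Tr(y^2). *)
have [w wE] : exists w : int, u * v = (l%:Z) ^+ b * w.
  have [c1 c1E] := OK_trace d_lt0 (OKX 2 Ox).
  have [c2 c2E] := OK_trace d_lt0 (OKX 2 Oy).
  exists (c1 + l%:Z ^+ (a - b) * c2); apply: (@intr_inj algC).
  rewrite !intrM intrD intrM !natXz_intr -uE -vE -c1E -c2E !(rmorphXn, rmorphM) /= conjCK.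
  by rewrite [RHS]mulrDr [X in _ = _ + X]mulrA -exprD subnKC // -xa -yb; ring.
have uv : u + v = s * t.
  apply: (@intr_inj algC).
  by rewrite intrD intrM -uE -vE -xs -yt !rmorphM /= conjCK; ring.
case: (boolP (l %| v)%Z) => lv.
  have lu : ~~ (l %| u)%Z.
    by rewrite -(rpredDr _ lv) uv dvdz_primeM negb_or ls lt.
  have lbv : (l%:Z ^+ b %| v)%Z.
    rewrite -(@Gauss_dvdzr _ u) ?wE ?dvdz_mulr //.
    exact/coprimezXl/coprimez_prime.
  have yb' : y^* * (y^*)^* = l%:R ^+ b by rewrite conjCK mulrC.
  have vE' : x * (y^*)^* + (x * (y^*)^*)^* = v%:~R by rewrite conjCK.
  have [e [Oe eN eE]] := trace_mul_conj_dvd Ox Oyc ba xa yb' vE' lbv.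
  by exists e; split => //; right.
have lbu : (l%:Z ^+ b %| u)%Z.
  rewrite -(@Gauss_dvdzl _ _ v) ?wE ?dvdz_mulr //.
  exact/coprimezXl/coprimez_prime.
have [e [Oe eN eE]] := trace_mul_conj_dvd Ox Oy ba xa yb uE lbu.
by exists e; split => //; left.
Qed.

(* For k > 0 the trace condition says that x is coprime to its conjugate. *)
Definition conj_coprime (k : nat) (x : algC) : Prop :=
  [/\ OK d x, x * x^* = l%:R ^+ k
    & exists2 t : int, x + x^* = t%:~R & ~~ (l %| t)%Z].

Lemma conj_coprime_conj k x : conj_coprime k x -> conj_coprime k x^*.
Proof.
move=> [Ox xn [t xt lt]]; split; rewrite ?conjCK; [auto | by rewrite mulrC |].
by exists t; rewrite ?conjCK // addrC.
Qed.

Lemma conj_coprimeX k j x : (0 < k)%N -> (0 < j)%N ->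
  conj_coprime k x -> conj_coprime (k * j) (x ^+ j).
Proof.
case: j => // j k0 _ [Ox xn [t xt lt]]; split; [auto | |].
  by rewrite rmorphXn /= -exprMn xn exprM.
apply: (@trace_pow_ndvd x t (l%:Z ^+ k) j) => //.
  by rewrite xn natXz_intr.
by rewrite dvdz_exp.
Qed.

Lemma conj_coprime_ndvd k x w : conj_coprime k x -> OK d w -> x <> l%:R * w.
Proof. by move=> [_ _ [t xt lt]]; exact: trace_ndvd_mul xt lt. Qed.

Lemma conj_coprime_dvd a b x y : (b <= a)%N -> conj_coprime a x -> conj_coprime b y ->
  exists e, [/\ OK d e, e * e^* = l%:R ^+ (a - b) & x = e * y \/ x = e * y^*].
Proof.
move=> ba [Ox xn [s xs ls]] [Oy yn [t yt lt]].
exact: norm_prime_power_dvd xn yn xs yt ls lt.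
Qed.

(** If l divided the trace, x^2 = Tr(x) x - l^k would be a multiple of l. In this form the
    hypothesis is inherited by the divisors of an element coprime to its conjugate. *)
Lemma norm_ndvd_trace k x : (0 < k)%N -> OK d x -> x * x^* = l%:R ^+ k ->
  (forall w, OK d w -> x ^+ 2 <> l%:R * w) -> conj_coprime k x.
Proof.
case: k => // k _ Ox xn nd; split => //.
have [t xt] := OK_trace d_lt0 Ox; exists t => //; apply/negP => /dvdzP[c tE].
apply: (nd (c%:~R * x - l%:R ^+ k)); first by rewrite -natXz_intr; auto.
rewrite mulrBr -exprS -xn; transitivity ((x + x^*) * x - x * x^*); first by ring.
by rewrite xt tE intrM -[l%:~R]/(l%:R); ring.
Qed.

(** * The prime ideal (l, al) and its powers *)

Definition gen2 (x y z : algC) : Prop :=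
  exists u v, [/\ OK d u, OK d v & z = x * u + y * v].

Lemma gen2_ideal x y : OK d x -> OK d y -> is_ideal d (gen2 x y).
Proof.
move=> Ox Oy; split.
- by move=> _ [u [v [Ou Ov ->]]]; auto.
- by exists 0, 0; split; rewrite ?mulr0 ?addr0; auto.
- move=> _ _ [u [v [Ou Ov ->]]] [u' [v' [Ou' Ov' ->]]].
  by exists (u + u'), (v + v'); split; auto; ring.
- move=> r _ Or [u [v [Ou Ov ->]]].
  by exists (r * u), (r * v); split; auto; ring.
Qed.

Lemma bezout_intr (c : int) : ~~ (l %| c)%Z ->
  exists u v : int, 1 = u%:~R * c%:~R + v%:~R * l%:R :> algC.
Proof.
move=> /coprimez_prime /coprimezP[[v u] /= uv]; exists u, v.
by rewrite -[l%:R]/((l%:Z)%:~R) -!intrM -intrD addrC uv.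
Qed.

Section Primitive.
Variables (n : nat) (al : algC).
Hypotheses (n_gt0 : (0 < n)%N) (al_n : conj_coprime n al).

Let Oal : OK d al. Proof. by case: al_n. Qed.
Let al_normn : al * al^* = l%:R ^+ n. Proof. by case: al_n. Qed.
Let al_norm : al * al^* = l%:R * l%:R ^+ n.-1.
Proof. by rewrite al_normn -exprS prednK. Qed.
#[local] Hint Resolve Oal : core.

Local Notation P := (gen2 l%:R al).

(** Multiplying 1 = l u + al v by al' would make al' a multiple of l. *)
Lemma gen2_not1 : ~ P 1.
Proof.
move=> [u [v [Ou Ov E]]].
apply: (conj_coprime_ndvd (w := al^* * u + l%:R ^+ n.-1 * v) (conj_coprime_conj al_n)).
  by auto 6.
transitivity (al^* * (l%:R * u + al * v)); first by rewrite -E mulr1.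
transitivity (l%:R * al^* * u + al * al^* * v); first by ring.
by rewrite al_norm; ring.
Qed.

Lemma gen2_intr (c : int) : P c%:~R -> (l %| c)%Z.
Proof.
move=> Pc; apply/negPn/negP => /bezout_intr[u [v E]]; apply: gen2_not1.
have [_ _ PD PM] := gen2_ideal (OK_nat d l) Oal.
rewrite [X in P X]E; apply: (PD); apply: (PM); auto.
by exists 1, 0; split; rewrite ?mulr1 ?mulr0 ?addr0; auto.
Qed.

(* D = (al - al')^2 is prime to l, and D x = i + j al with i = -(x al' - x' al)(al - al')
   and j = (x - x')(al - al') rational integers. *)
Lemma gen2_residue x : OK d x -> exists c : int, P (x - c%:~R).
Proof.
move=> Ox; have [_ _ [t xt lt]] := al_n.
have [j jE] : exists j : int, (x - x^*) * (al - al^*) = j%:~R.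
  have [a aE] := OK_trace d_lt0 (OKM Ox Oal).
  have [b bE] := OK_trace d_lt0 (OKM Ox (OKd_conj Oal)).
  by exists (a - b); rewrite intrB -aE -bE !rmorphM /= conjCK; ring.
have [i iE] : exists i : int, - (x * al^* - x^* * al) * (al - al^*) = i%:~R.
  have [a aE] := OK_trace d_lt0 (OKM (OKd_conj Ox) (OKX 2 Oal)).
  have [b bE] := OK_trace d_lt0 Ox.
  exists (a - l%:Z ^+ n * b).
  rewrite intrB intrM natXz_intr -aE -bE !(rmorphXn, rmorphM) /= conjCK.
  by rewrite -al_normn; ring.
have [D DE lD] : exists2 D : int, (al - al^*) ^+ 2 = D%:~R & ~~ (l %| D)%Z.
  exists (t ^+ 2 - 4 * l%:Z ^+ n).
    rewrite intrB intrM natXz_intr rmorphXn /= -xt -al_normn.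
    by ring.
  by rewrite rpredBr ?dvdz_primeX // dvdz_mull // dvdz_exp.
have DxE : D%:~R * x = i%:~R + j%:~R * al by rewrite -DE -iE -jE; ring.
(* As u inverts D modulo l, x = u D x = u i + u j al modulo l. *)
have [u [v uv]] := bezout_intr lD.
exists (u * i), (v%:~R * x), (u%:~R * j%:~R); split; auto.
transitivity ((u%:~R * D%:~R + v%:~R * l%:R) * x - (u * i)%:~R).
  by rewrite -uv mul1r.
by rewrite mulrDl -[_ * _ * x]mulrA DxE intrM; ring.
Qed.

(** Every class modulo P contains an integer, and the integers of P are the multiples of l, so
    Euclid's lemma for l applies. *)
Lemma gen2_prime : prime_ideal d P.
Proof.
have [PO P0 PD PM] := gen2_ideal (OK_nat d l) Oal.
split; [exact: gen2_ideal | exact: gen2_not1 |].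
move=> x y Ox Oy Pxy.
have [i Pi] := gen2_residue Ox; have [j Pj] := gen2_residue Oy.
have : (l %| i * j)%Z.
  apply: gen2_intr.
  have -> : (i * j)%:~R = x * y + (- y) * (x - i%:~R) + (- i%:~R) * (y - j%:~R) :> algC.
    by rewrite intrM; ring.
  by apply: (PD); [apply: (PD) => // |]; apply: (PM); auto.
have Pl c : (l %| c)%Z -> P c%:~R.
  move=> /dvdzP[q ->]; exists q%:~R, 0; split; auto.
  by rewrite intrM mulr0 addr0 mulrC.
rewrite dvdz_primeM => /orP[/Pl|/Pl] h; [left | right].
  by rewrite -(subrK i%:~R x); exact: PD.
by rewrite -(subrK j%:~R y); exact: PD.
Qed.

Lemma ideal_mul_sub (I J K : algC -> Prop) : K 0 -> (forall x y, K x -> K y -> K (x + y)) ->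
  (forall x y, I x -> J y -> K (x * y)) -> forall z, ideal_mul I J z -> K z.
Proof.
move=> K0 KD IJK _ [s [sIJ ->]]; rewrite big_seq; apply: big_ind => // p /sIJ[Ip Jp].
exact: IJK.
Qed.

(** Induction on k. One inclusion uses al^2 = t al - l^n with k < n; the other one uses that t is
    invertible modulo l. *)
Lemma gen2_pow k : (k <= n)%N ->
  ideal_eq (ideal_pow d P k) (gen2 (l%:R ^+ k) al).
Proof.
elim: k => [|k IH] kn.
  move=> x; split=> [/= Ox|[u [v [Ou Ov ->]]]]; last by rewrite /= expr0; auto.
  by exists x, 0; split; rewrite ?mulr0 ?addr0 ?expr0 ?mul1r; auto.
have {}IH := IH (ltnW kn).
have [_ _ [t xt lt]] := al_n.
have Olk m : OK d (l%:R ^+ m) by auto.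
have al2 : al ^+ 2 = t%:~R * al - l%:R ^+ k.+1 * l%:R ^+ (n - k.+1).
  by rewrite -exprD subnKC // -al_normn -xt; ring.
have [_ K0 KD KM] := gen2_ideal (Olk k.+1) Oal.
move=> z; split.
  apply: ideal_mul_sub => // x y [u [v [Ou Ov ->]]] /IH[u' [v' [Ou' Ov' ->]]].
  exists (u * u' - l%:R ^+ (n - k.+1) * (v * v')),
         (l%:R * u * v' + v * l%:R ^+ k * u' + t%:~R * v * v').
  split; [by auto 7 | by auto 7 |].
  transitivity (l%:R ^+ k.+1 * (u * u') + al * (l%:R * u * v' + v * l%:R ^+ k * u')
                + al ^+ 2 * (v * v')); first by rewrite exprS; ring.
  by rewrite al2; ring.
move=> [u [v [Ou Ov ->]]]; have [a [b ab]] := bezout_intr lt.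
have Pl : P l%:R by exists 1, 0; split; auto; ring.
have Pal : P al by exists 0, 1; split; auto; ring.
have Kl w : OK d w -> ideal_pow d P k (l%:R ^+ k * w).
  by move=> Ow; apply/IH; exists w, 0; split; auto; ring.
have Kal w : OK d w -> ideal_pow d P k (al * w).
  by move=> Ow; apply/IH; exists 0, w; split; auto; ring.
(* With a t + b l = 1 and t al = al^2 + l^n, al v = al (al a v) + l^n a v + l (al b v). *)
exists [:: (l%:R, l%:R ^+ k * (u + l%:R ^+ (n - k.+1) * (a%:~R * v)));
           (l%:R, al * (b%:~R * v)); (al, al * (a%:~R * v))]; split.
  by move=> p; rewrite !inE => /or3P[]/eqP-> /=; split; auto 7.
rewrite !big_cons big_nil /= addr0.
have -> : al * v = (a%:~R * t%:~R + b%:~R * l%:R) * (al * v) by rewrite -ab mul1r.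
have -> : al * (al * (a%:~R * v)) = al ^+ 2 * (a%:~R * v) by ring.
by rewrite al2 exprS; ring.
Qed.

(** In (l^n, al) the first generator is al al', a multiple of the second. *)
Lemma gen2_pow_top : is_principal d (ideal_pow d P n).
Proof.
exists al; split=> // z; split.
  move/(gen2_pow (leqnn n)) => [u [v [Ou Ov ->]]].
  exists (al^* * u + v); split; first by auto.
  by rewrite mulrDr mulrA al_norm -exprS prednK.
move=> [r [Or ->]]; apply/(gen2_pow (leqnn n)); exists 0, r; split; auto.
by rewrite mulr0 add0r.
Qed.

(** A generator g of (l^k, al) has norm c = l^k, by divisibility both ways and c >= 0; its trace is
    then handled by [norm_ndvd_trace]. *)
Lemma gen2_principal_gen k : (0 < k < n)%N -> is_principal d (ideal_pow d P k) ->
  exists g, conj_coprime k g.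
Proof.
move=> /andP[k0 kn] [g [Og gE]].
have gP z : gen2 (l%:R ^+ k) al z <-> pideal d g z.
  by rewrite -gE; split=> h; apply/(gen2_pow (ltnW kn)).
have [_ _ [t xt lt]] := al_n.
have Olk m : OK d (l%:R ^+ m) by auto.
have lC m : (l%:R ^+ m : algC)^* = l%:R ^+ m by rewrite rmorphXn /= rmorph_nat.
have L0 m : (l%:R ^+ m : algC) != 0.
  by rewrite expf_neq0 // pnatr_eq0 -lt0n prime_gt0.
have alE : al * al^* = l%:R ^+ k * l%:R ^+ (n - k).
  by rewrite al_normn -exprD subnKC // ltnW.
have [de [Ode deE]] : pideal d g (l%:R ^+ k).
  by apply/gP; exists 1, 0; split; auto; ring.
have [ep [Oep epE]] : pideal d g al by apply/gP; exists 0, 1; split; auto; ring.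
have [u [v [Ou Ov uvE]]] : gen2 (l%:R ^+ k) al g.
  by apply/gP; exists 1; split; rewrite ?mulr1; auto.
have [c cE] := OK_norm d_lt0 Og.
(* With a t + b l^k = 1, l^k = a (l^k al + l^k al') + b l^k l^k, and each product pairs a multiple
   of g with a multiple of g'. *)
have c_dvd : (c %| l%:Z ^+ k)%Z.
  have /coprimezP[[b a] /= ab] : coprimez (l%:Z ^+ k) t by exact/coprimezXl/coprimez_prime.
  have deC : l%:R ^+ k = g^* * de^* by rewrite -rmorphM /= -deE lC.
  have epC : al^* = g^* * ep^* by rewrite -rmorphM /= -epE.
  pose w := a%:~R * (de^* * ep + de * ep^*) + b%:~R * (de * de^*).
  have wE : l%:R ^+ k = c%:~R * w.
    transitivity (a%:~R * (l%:R ^+ k * al + l%:R ^+ k * al^*)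
                  + b%:~R * (l%:R ^+ k * l%:R ^+ k)).
      transitivity (l%:R ^+ k * (a%:~R * t%:~R + b%:~R * l%:R ^+ k) : algC).
        move/(congr1 (fun z : int => z%:~R : algC)): ab.
        by rewrite intrD !intrM natXz_intr addrC => ->; rewrite mulr1.
      by rewrite -mulrDr xt; ring.
    by rewrite {1}deC {1}epE {1}deE epC {1}deE deC -cE /w; ring.
  have Ow : OK d w by rewrite /w; auto 8.
  have c0 : c%:~R != 0 :> algC.
    by apply: contra_eq_neq wE => ->; rewrite mul0r.
  have [w' w'E] : exists w' : int, w = w'%:~R.
    apply: (OK_rat _ Ow); have -> : w = l%:R ^+ k / c%:~R by rewrite wE mulrC mulKf.
    by rewrite -natXz_intr rpred_div ?rpred_int.
  apply/dvdzP; exists w'; apply: (@intr_inj algC).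
  by rewrite natXz_intr wE w'E -intrM mulrC.
(* In the norm of l^k u + al v every term carries l^k, since al al' = l^n. *)
have dvd_c : (l%:Z ^+ k %| c)%Z.
  pose y := l%:R ^+ k * u * u^* + u * al^* * v^* + u^* * al * v + l%:R ^+ (n - k) * v * v^*.
  have yE : c%:~R = l%:R ^+ k * y.
    rewrite -cE uvE rmorphD !rmorphM /= lC /y.
    transitivity (l%:R ^+ k * (l%:R ^+ k * u * u^* + u * al^* * v^* + u^* * al * v)
                  + al * al^* * (v * v^*)); first by ring.
    by rewrite alE; ring.
  have Oy : OK d y by rewrite /y; auto 8.
  have [y' y'E] : exists y' : int, y = y'%:~R.
    apply: (OK_rat _ Oy); have -> : y = c%:~R / l%:R ^+ k by rewrite yE mulrC mulKf.
    by rewrite -natXz_intr rpred_div ?rpred_int.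
  apply/dvdzP; exists y'; apply: (@intr_inj algC).
  by rewrite intrM natXz_intr yE y'E mulrC.
exists g; apply: norm_ndvd_trace => //.
  have c_ge0 : 0 <= c by rewrite -(ler0z algC) -cE mul_conjC_ge0.
  rewrite cE -natXz_intr; congr (_%:~R).
  have : (`|c| == `|l%:Z ^+ k|)%N by rewrite eqn_dvd; apply/andP; split.
  by rewrite -eqz_nat !gez0_abs ?exprn_ge0 // => /eqP.
(* As g divides al, l would divide al^2. *)
move=> w Ow g2; apply: (conj_coprime_ndvd (w := w * ep ^+ 2) (conj_coprimeX n_gt0 (ltn0Sn 1) al_n)).
  by auto.
by rewrite epE exprMn g2 mulrA.
Qed.

End Primitive.

(* If l^k has a generator coprime to its conjugate for some k < n, Bezout turns al and that
   generator into one of level gcd(k, n), hence a prime-index root of al up to a unit. *)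
Lemma conj_coprime_root n al k g : (0 < k < n)%N ->
  conj_coprime n al -> conj_coprime k g ->
  exists p b e, [/\ prime p, (p %| n)%N, conj_coprime (n %/ p) b
                  & [/\ OK d e, e * e^* = 1 & b ^+ p = e * al]].
Proof.
move=> /andP[k0 kn] al_n g_k.
have n0 : (0 < n)%N := ltn_trans k0 kn.
have [i0 j0 ij0 _] := egcdnP n k0.
set m := gcdn k n in ij0; have m0 : (0 < m)%N by rewrite gcdn_gt0 k0.
(* The Bezout exponents are shifted so that both are positive, as [conj_coprimeX] requires. *)
pose i := (i0 + n)%N; pose j := (j0 + k)%N.
have ij : (k * i = n * j + m)%N by rewrite /i /j; lia.
have gi : conj_coprime (k * i) (g ^+ i) by apply: conj_coprimeX => //; lia.
have alj : conj_coprime (n * j) (al ^+ j) by apply: conj_coprimeX => //; lia.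
have le : (n * j <= k * i)%N by rewrite ij leq_addr.
(* Dividing g^i by al^j or its conjugate leaves an element of norm l^m. *)
have [de [Ode deN deE]] := conj_coprime_dvd le gi alj.
have [y [Oy gy]] : exists y, OK d y /\ g ^+ i = de * y.
  by case: alj deE => Oal _ _ [->|->]; [exists (al ^+ j) | exists (al ^+ j)^*]; auto.
have de_m : conj_coprime m de.
  apply: norm_ndvd_trace => //; first by rewrite deN ij addKn.
  move=> w Ow de2; have i_gt0 : (0 < k * i)%N by rewrite ij; lia.
  apply: (conj_coprime_ndvd (w := w * y ^+ 2) (conj_coprimeX i_gt0 (ltn0Sn 1) gi)).
    by auto.
  by rewrite gy exprMn de2 mulrA.
have mn : (m %| n)%N by exact: dvdn_gcdr.
pose q := (n %/ m)%N; have nq : (n = m * q)%N by rewrite mulnC divnK.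
have q_gt1 : (1 < q)%N.
  have : (m <= k)%N by rewrite dvdn_leq // dvdn_gcdl.
  by move=> mk; rewrite ltn_divRL // mul1n (leq_ltn_trans mk).
pose p := pdiv q; have p_pr : prime p by exact: pdiv_prime.
have pq : (p %| q)%N by exact: pdiv_dvd.
have q'_gt0 : (0 < q %/ p)%N by rewrite divn_gt0 ?prime_gt0 // dvdn_leq // ltnW.
have b_np : conj_coprime (n %/ p) (de ^+ (q %/ p)).
  by rewrite {1}nq -muln_divA //; exact: conj_coprimeX.
have bp : conj_coprime n ((de ^+ (q %/ p)) ^+ p).
  by rewrite -exprM divnK // {1}nq; apply: conj_coprimeX => //; exact: ltnW.
have pn : (p %| n)%N by rewrite nq dvdn_mull.
have [e [Oe eN eE]] := conj_coprime_dvd (leqnn n) bp al_n.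
rewrite subnn expr0 in eN.
(* If b^p is e al' instead of e al, everything is conjugated. *)
case: eE => eE; first by exists p, (de ^+ (q %/ p)), e; split.
exists p, (de ^+ (q %/ p))^*, e^*; split => //; first exact: conj_coprime_conj.
split; [auto | by rewrite conjCK mulrC |].
by rewrite -rmorphXn /= eE rmorphM /= conjCK.
Qed.

(** Reduces the class group statement to powers of elements: the primes are (l, al) and (l, al'),
    and a principal proper power of either one yields a root of al up to a unit. *)
Lemma splits_of_no_root n al : (0 < n)%N -> conj_coprime n al ->
  (forall p b e, prime p -> (p %| n)%N -> conj_coprime (n %/ p) b ->
     OK d e -> e * e^* = 1 -> b ^+ p <> e * al) ->
  splits_with_class_order d l n.
Proof.
move=> n0 al_n no_root; have alC_n := conj_coprime_conj al_n.
have order x : conj_coprime n x -> (forall k, (0 < k < n)%N ->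
    forall g, conj_coprime k g -> False) -> class_order d (gen2 l%:R x) n.
  move=> x_n no_g; split=> //; first exact: gen2_pow_top.
  by move=> k kn /(gen2_principal_gen n0 x_n kn)[g /(no_g _ kn)].
have no_g k : (0 < k < n)%N -> forall g, conj_coprime k g -> False.
  move=> kn g /(conj_coprime_root kn al_n)[p [b [e [p_pr pn b_n [Oe eN]]]]].
  exact: no_root.
exists (gen2 l%:R al), (gen2 l%:R al^*); split.
- exact: gen2_prime al_n.
- exact: gen2_prime alC_n.
(* If the two ideals agreed, al + al' = t would lie in P, and l would divide t. *)
- move=> eq; have [Oal _ [t xt /negP]] := al_n; apply.
  apply: (gen2_intr n0 al_n); rewrite -xt.
  have [_ _ PD _] := gen2_ideal (OK_nat d l) Oal.
  apply: PD; first by exists 0, 1; split; auto; ring.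
  by apply/eq; exists 0, 1; split; auto; ring.
- have [Oal aln [t xt lt]] := al_n; have OalC := OKd_conj Oal.
  have al_norm : al * al^* = l%:R * l%:R ^+ n.-1 by rewrite aln -exprS prednK.
  move=> z; split; last first.
    (* The principal ideal (l) is treated as (l, 0). *)
    have [_ K0 KD KM] := gen2_ideal (OK_nat d l) (OK0 d).
    move=> h; have [u [v [Ou Ov ->]]] : gen2 l%:R 0 z.
      apply: ideal_mul_sub h => // x y [u [v [Ou Ov ->]]] [u' [v' [Ou' Ov' ->]]].
      exists (l%:R * u * u' + u * al^* * v' + u' * al * v + l%:R ^+ n.-1 * v * v'), 0.
      split; [by auto 7 | by auto |].
      transitivity (l%:R * (l%:R * u * u' + u * al^* * v' + u' * al * v)
                    + al * al^* * (v * v')); first by ring.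
      by rewrite al_norm; ring.
    by exists u; rewrite mul0r addr0.
  (* With u t + v l = 1, l r = u r l (al + al') + v r l l. *)
  move=> [r [Or ->]]; have [u [v uv]] := bezout_intr lt.
  have g2l x : gen2 l%:R x l%:R by exists 1, 0; split; auto; ring.
  have g2x x : gen2 l%:R x x by exists 0, 1; split; auto; ring.
  have [_ _ _ PM] := gen2_ideal (OK_nat d l) Oal.
  have [_ _ _ PM'] := gen2_ideal (OK_nat d l) OalC.
  exists [:: (l%:R, (u%:~R * r) * al^*); (al, (u%:~R * r) * l%:R);
             (l%:R, (v%:~R * r) * l%:R)]; split.
    by move=> p; rewrite !inE => /or3P[]/eqP-> /=; split; auto.
  rewrite !big_cons big_nil /= addr0.
  transitivity (l%:R * ((u%:~R * t%:~R + v%:~R * l%:R) * r)); first by rewrite -uv mul1r.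
  by rewrite -xt; ring.
- by split; apply: order.
Qed.

End Splitting.

(** * Units and traces of powers *)

Lemma dvdz_Aint (p m : int) z : p != 0 -> z \in Aint -> p%:~R * z = m%:~R -> (p %| m)%Z.
Proof.
move=> p0 zA E; have [q qE] : exists q : int, z = q%:~R.
  apply/intrP/Cint_rat_Aint => //.
  have -> : z = m%:~R / p%:~R by rewrite -E mulrC mulKf // intr_eq0.
  by rewrite rpred_div ?rpred_int.
apply/dvdzP; exists q; apply: (@intr_inj algC).
by rewrite -E qE intrM mulrC.
Qed.

Lemma rat_sqr_int (x : rat) (c : int) : x ^+ 2 = c%:~R -> exists m : int, c = m ^+ 2.
Proof.
move=> xc; have xA : ratr x \in Aint.
  apply: (@Aint_quadratic _ 0 (- c)); rewrite mul0r sub0r -rmorphXn /= xc ratr_int.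
  by rewrite intrN opprK.
have /intrP[m mE] := Cint_rat_Aint (Crat_rat x) xA.
exists m; apply: (@intr_inj algC).
by rewrite -ratr_int -xc rmorphXn /= mE rmorphXn.
Qed.

(* If s = Tr e and e = a + b sqrt d then 4 d b^2 = s^2 - 4, so |s| <= 2. *)
Lemma norm1_cases (d : int) e : d < 0 -> OK d e -> e * e^* = 1 ->
  [\/ e = 1, e = -1, exists c : int, - d = c ^+ 2
    | (exists c : int, - d = 3 * c ^+ 2) /\ (e ^+ 3 = 1 \/ e ^+ 3 = -1)].
Proof.
move=> d0 Oe eN; have [s sE] := OK_trace d0 Oe.
have [[a [b eE]] _] := Oe.
have ebd : (e - e^*) ^+ 2 = ratr (4 * b ^+ 2 * d%:~R).
  rewrite (rmorphM _ _ d%:~R) (rmorphM _ 4) (rmorphXn _ 2 b) /= ratr_int ratr_nat -[d%:~R]sqrtCK.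
  rewrite {2}eE conjC_Qsqrt // {1}eE; ring.
have sd : 4 * b ^+ 2 * d%:~R = (s ^+ 2 - 4)%:~R :> rat.
  have : ratr (4 * b ^+ 2 * d%:~R) = ratr (s ^+ 2 - 4)%:~R :> algC; last exact: fmorph_inj.
  rewrite -ebd ratr_int intrB rmorphXn /= -sE.
  transitivity ((e + e^*) ^+ 2 - 4 * (e * e^*)); first by ring.
  by rewrite eN mulr1.
have s2 : s ^+ 2 <= 4.
  rewrite -subr_le0 -(ler_int rat) -sd; apply: mulr_ge0_le0.
    by rewrite mulr_ge0 ?sqr_ge0.
  by rewrite lerz0 ltW.
have : [\/ s = 0, s = 1 \/ s = -1 | s = 2 \/ s = -2].
  have : -2 <= s <= 2 by nia.
  move=> /andP[]; case: s {sE sd s2} => [[|[|[|s]]]|[|[|s]]] h1 h2;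
   solve [by constructor | by constructor; left | by constructor; right | lia].
case=> [s0|s1|s4].
(* Here 4 d b^2 = -4, so -d is the square of 1 / b. *)
- apply: Or43; rewrite s0 in sd.
  have b0 : b != 0 by apply: contra_eq_neq sd => ->; rewrite expr0n mulr0 mul0r.
  apply: (@rat_sqr_int b^-1).
  have -> : (- d)%:~R = - (4 * b ^+ 2 * d%:~R) / (4 * b ^+ 2) :> rat.
    by rewrite intrN; field.
  by rewrite sd; field.
- apply: Or44; split; last first.
    have e2 : e ^+ 2 = s%:~R * e - 1 by rewrite -sE -eN; ring.
    have : e ^+ 3 = e * e ^+ 2 by ring.
    rewrite e2 mulrBr mulrCA -expr2 e2.
    by case: s1 => -> ->; [right|left]; ring.
  have b0 : b != 0.
    by apply: contra_eq_neq sd => ->; rewrite expr0n mulr0 mul0r; case: s1 => ->.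
  have sd' : 4 * b ^+ 2 * d%:~R = - 3 :> rat by rewrite sd; case: s1 => ->.
  (* From 4 d b^2 = -3, -3 d is the square of 3 / (2 b); then 3 divides its root. *)
  have [m mE] : exists m : int, - 3 * d = m ^+ 2.
    apply: (@rat_sqr_int (3 / (2 * b))).
    have -> : (- 3 * d)%:~R = - 3 * (4 * b ^+ 2 * d%:~R) / (4 * b ^+ 2) :> rat.
      by rewrite intrM; field.
    by rewrite sd'; field.
  have : (3 %| m ^+ 2)%Z by rewrite -mE mulNr -mulrN dvdz_mulr.
  rewrite (@dvdz_primeX 3) // => /dvdzP[c cE]; exists c; move: mE; rewrite cE; lia.
- have b0 : b = 0.
    have : 4 * b ^+ 2 * d%:~R = 0 :> rat by rewrite sd; case: s4 => ->.
    move/eqP; rewrite mulf_eq0 (mulf_eq0 4) sqrf_eq0 intr_eq0 pnatr_eq0 /=.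
    by rewrite (lt_eqF d0) orbF => /eqP.
  have ee : e = e^* by rewrite eE conjC_Qsqrt // b0 rmorph0 mul0r subr0 addr0.
  have : e * 2 = s%:~R by rewrite -sE -ee; ring.
  move=> e2; have -> : e = s%:~R / 2 by rewrite -e2; field.
  by case: s4 => ->; [apply: Or41 | apply: Or42]; field.
Qed.

(** In Tr(b^(m+2)) = a Tr(b^(m+1)) - N Tr(b^m) the factor a passes from each odd exponent to the
    next. *)
Lemma trace_odd_pow (d a : int) b k : d < 0 -> OK d b -> b + b^* = a%:~R ->
  exists q : int, b ^+ k.*2.+1 + b^* ^+ k.*2.+1 = (a * q)%:~R.
Proof.
move=> d0 Ob ab; elim: k => [|k [q IH]]; first by exists 1; rewrite mulr1.
have [N NE] := OK_norm d0 Ob; have [T TE] := OK_trace d0 (OKX k.*2.+2 Ob).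
exists (T - N * q).
have -> : a * (T - N * q) = a * T - N * (a * q) by ring.
rewrite intrB [in RHS]intrM [(N * _)%:~R]intrM -IH -TE -ab -NE doubleS rmorphXn /= !exprS.
by ring.
Qed.

Lemma trace_odd_pow_dvd (d a : int) b p : d < 0 -> OK d b -> b + b^* = a%:~R -> odd p ->
  exists q : int, b ^+ p + b^* ^+ p = (a * q)%:~R.
Proof.
move=> d0 Ob ab op; have := odd_double_half p; rewrite op add1n => <-.
exact: (trace_odd_pow _ d0 Ob ab).
Qed.

Lemma expr1B_prime (p : nat) x : prime p -> odd p -> x \in Aint ->
  exists2 A, A \in Aint & (1 - x) ^+ p = 1 - x ^+ p - p%:R * x + p%:R * x ^+ 2 * A.
Proof.
move=> p_pr op xA; case: p p_pr op => [|[|[|p]]] // p_pr op.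
(* The prime is now [p.+3]; the sum collects the degrees 2 to p + 2, whose binomial coefficients it
   divides. *)
exists (\sum_(i < p.+1) (- x) ^+ i *+ ('C(p.+3, i.+2) %/ p.+3)).
  by apply: rpred_sum => i _; rewrite rpredMn // rpredX // rpredN.
rewrite exprDn big_ord_recl big_ord_recl big_ord_recr /= !expr1n bin0 bin1 binn.
rewrite mulr1n !mul1r expr0 expr1 !mulr1n (exprNn x p.+3) -signr_odd op expr1 mulN1r.
set A := (X in _ = _ + _ * X); set S := (X in _ + (_ + (X - _))).
have -> : S = p.+3%:R * x ^+ 2 * A.
  rewrite mulr_sumr; apply: eq_bigr => i _; rewrite expr1n mul1r /bump !add1n.
  have /divnK {1}<- : (p.+3 %| 'C(p.+3, i.+2))%N.
    by apply: prime_dvd_bin => //=; rewrite ltnS ltnS ltn_ord.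
  move: ('C(_, _) %/ _)%N => c; rewrite (exprS (- x)) (exprS (- x)) mulrnA.
  rewrite -[LHS]mulr_natl [LHS]mulrnAr [RHS]mulrnAr; congr (_ *+ c).
  by move: (p.+3%:R : algC) ((- x) ^+ i) => P y; ring.
rewrite -mulr_natl; move: A (x ^+ p.+3) (p.+3%:R : algC) => A y P; ring.
Qed.

(* By [expr1B_prime] with x = b', the trace of b^p is 1 - p x (1 - x A): it is 1 modulo p,
   hence 1, and then x is a unit. *)
Lemma trace1_pow_neq_unit (d N : int) (p : nat) b : d < 0 -> OK d b -> prime p -> odd p ->
  b + b^* = 1 -> b * b^* = N%:~R -> 1 < N ->
  ~ (b ^+ p + b^* ^+ p = 1 \/ b ^+ p + b^* ^+ p = -1).
Proof.
move=> d0 Ob p_pr op b1 bN N1.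
have xA : b^* \in Aint by case: (OK_conj d0 Ob).
have [A AA AE] := expr1B_prime p_pr op xA.
have p0 : p%:R != 0 :> algC by rewrite pnatr_eq0 -lt0n prime_gt0.
have {}AE : b ^+ p + b^* ^+ p = 1 - p%:R * (b^* * (1 - b^* * A)).
  have bE : 1 - b^* = b by rewrite -b1 addrK.
  by rewrite bE in AE; rewrite AE; ring.
rewrite AE; case=> E.
  have {}E : b^* * (1 - b^* * A) = 0.
    apply: (mulfI p0); rewrite mulr0; apply/eqP; rewrite -oppr_eq0; apply/eqP.
    by apply: (addrI 1); rewrite E addr0.
  have x0 : b^* != 0.
    apply: contra_eq_neq bN => ->; rewrite mulr0 eq_sym intr_eq0.
    by apply/eqP => N0; rewrite N0 in N1.
  have xA1 : b^* * A = 1.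
    by move/eqP: E; rewrite mulf_eq0 (negPf x0) subr_eq0 => /eqP.
  (* Take norms in x A = 1. *)
  have : (N %| 1)%Z.
    apply: (@dvdz_Aint N 1 (A * A^*)); first by apply: contraTneq N1 => ->.
      by rewrite rpredM // Aint_aut.
    have : (b^* * A) * (b^* * A)^* = 1 by rewrite xA1 mul1r rmorph1.
    by rewrite rmorphM /= conjCK -bN => <-; ring.
  by rewrite dvdz1 => /eqP; lia.
(* The value -1 would make 2 a multiple of p. *)
have : (p %| 2)%Z.
  apply: (@dvdz_Aint p 2 (b^* * (1 - b^* * A))).
  - by rewrite -lt0n prime_gt0.
  - by rewrite rpredM ?rpredB ?rpredM ?Aint1.
  - transitivity (1 - (1 - p%:R * (b^* * (1 - b^* * A)))); first by rewrite -[p%:~R]/(p%:R); ring.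
    by rewrite E; ring.
rewrite dvdzE /= => /dvdn_leq -/(_ isT); case: p p_pr op {AE E p0} => [|[|[|p]]] //.
Qed.

(** As p is odd, Tr(b) divides Tr(b^p) and is 1 or -1; replacing b by -b reduces to Tr(b) = 1. *)
Lemma pow_trace_neq_unit (d N : int) (p : nat) b : d < 0 -> OK d b -> prime p -> odd p ->
  b * b^* = N%:~R -> 1 < N -> ~ (b ^+ p + b^* ^+ p = 1 \/ b ^+ p + b^* ^+ p = -1).
Proof.
move=> d0 Ob p_pr op bN N1 h.
have [a aE] := OK_trace d0 Ob.
have [q qE] := trace_odd_pow_dvd d0 Ob aE op.
have aq : a * q = 1 \/ a * q = -1.
  by case: h => h; [left | right]; apply: (@intr_inj algC); rewrite -qE h.
have : a = 1 \/ a = -1.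
  have : (`|a| * `|q|)%N = 1%N by case: aq => /(congr1 absz); rewrite abszM.
  by move/eqP; rewrite muln_eq1 => /andP[/eqP]; lia.
case=> a1; rewrite a1 in aE; first exact: (@trace1_pow_neq_unit d N p b).
have xN k : odd k -> (- b) ^+ k + (- b)^* ^+ k = - (b ^+ k + b^* ^+ k).
  by move=> ok; rewrite rmorphN /= (exprNn b) (exprNn b^*) -signr_odd ok expr1; ring.
apply: (@trace1_pow_neq_unit d N p (- b) d0 (OKN Ob) p_pr op _ _ N1).
- by rewrite rmorphN /= -opprD aE intrN opprK.
- by rewrite rmorphN /= mulrNN.
- by rewrite xN //; case: h => ->; [right | left; rewrite opprK].
Qed.

(** A 2-adic expansion: squaring doubles the deviation from 1 without changing the parities of x and
    y, because 4 divides E; multiplying m such factors adds x and y modulo 2. The same x and y serve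
    e and -e, hence both conjugates. *)
Lemma pow2_expansion (E : int) (r m : nat) : (4 %| E)%Z ->
  exists x y : int, [/\ (2 %| x - m%:Z)%Z, (2 %| y - m%:Z)%Z
    & forall e : algC, e ^+ 2 = E%:~R ->
      (1 + e) ^+ (2 ^ r.+1 * m) = 1 + 2 ^+ r * (E%:~R * x%:~R + 2 * y%:~R * e)].
Proof.
move=> /dvdzP[F EF].
have [x1 [y1 [/dvdzP[u uE] /dvdzP[v vE] E1]]] : exists x y : int,
    [/\ (2 %| x - 1)%Z, (2 %| y - 1)%Z
      & forall e : algC, e ^+ 2 = E%:~R ->
        (1 + e) ^+ (2 ^ r.+1) = 1 + 2 ^+ r * (E%:~R * x%:~R + 2 * y%:~R * e)].
  elim: r => [|r [x [y [xo yo IH]]]].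
    exists 1, 1; split=> // e eE; rewrite expn1 expr0 mul1r.
    transitivity (1 + (e ^+ 2 + 2 * e)); [ring | rewrite eE; ring].
  exists (x + 2 ^+ r.+1 * (F * x ^+ 2 + y ^+ 2)), (y + 2 ^+ r * E * x * y); split.
  - have -> : x + 2 ^+ r.+1 * (F * x ^+ 2 + y ^+ 2) - 1
             = 2 * (2 ^+ r * (F * x ^+ 2 + y ^+ 2)) + (x - 1) by rewrite exprS; ring.
    by rewrite rpredD // dvdz_mulr.
  - have -> : y + 2 ^+ r * E * x * y - 1 = 2 * (2 ^+ r * (2 * F) * x * y) + (y - 1).
      by rewrite EF; ring.
    by rewrite rpredD // dvdz_mulr.
  move=> e eE; rewrite expnSr exprM (IH _ eE) !(intrD, intrM, rmorphXn) /= !exprS !expr0 !mulr1.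
  have eE' : e * e = E%:~R by rewrite -expr2.
  move: (2 ^+ r : algC) => P.
  transitivity (1 + 2 * P * (E%:~R * x%:~R + 2 * y%:~R * e)
     + P * P * (E%:~R * E%:~R * x%:~R * x%:~R + 4 * E%:~R * x%:~R * y%:~R * e
                + 4 * y%:~R * y%:~R * (e * e))); first by ring.
  rewrite eE' EF !intrM; ring.
elim: m => [|m [x [y [/dvdzP[a aE] /dvdzP[c cE] IH]]]].
  by exists 0, 0; split=> // e eE; rewrite muln0 expr0; ring.
exists (x + x1 + 2 ^+ r * (E * x * x1 + 4 * y * y1)),
       (y + y1 + 2 ^+ r * E * (x * y1 + x1 * y)); split.
- apply/dvdzP; exists (a + u + 2 ^+ r * (2 * F * x * x1 + 2 * y * y1)).
  by rewrite EF; move: (2 ^+ r : int) => P; lia.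
- apply/dvdzP; exists (c + v + 2 ^+ r * (2 * F) * (x * y1 + x1 * y)).
  by rewrite EF; move: (2 ^+ r : int) => P; lia.
move=> e eE; rewrite mulnS exprD (E1 _ eE) (IH _ eE) !(intrD, intrM, rmorphXn) /=.
have eE' : e * e = E%:~R by rewrite -expr2.
move: (2 ^+ r : algC) => P.
transitivity (1 + P * (E%:~R * (x%:~R + x1%:~R) + 2 * (y%:~R + y1%:~R) * e)
   + P * P * (E%:~R * E%:~R * x%:~R * x1%:~R + 2 * E%:~R * (x%:~R * y1%:~R + x1%:~R * y%:~R) * e
              + 4 * y%:~R * y1%:~R * (e * e))); first by ring.
by rewrite eE'; ring.
Qed.

(** Put b = 1 + e, M = e^2 = 1 - N < 0 and p = 2^(r+1) m + 1 with m odd. Then Tr(b^p) = 2 (1 + 2^r M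
    (x + 2 y)) with x odd: the value 2 would need x + 2 y = 0, and -2 would need 2^r M (x + 2 y) =
    -2, although 4 divides M. *)
Lemma trace2_pow_neq (d N : int) (p : nat) b : d < 0 -> OK d b -> odd p -> (1 < p)%N ->
  b + b^* = 2 -> b * b^* = N%:~R -> (4 %| 1 - N)%Z -> 1 < N ->
  ~ (b ^+ p + b^* ^+ p = 2 \/ b ^+ p + b^* ^+ p = -2).
Proof.
move=> d0 Ob op p1 b2 bN N4 N1.
pose e := b - 1; have bE : b = 1 + e by rewrite /e; ring.
have bCE : b^* = 1 + - e by transitivity (b + b^* - b); [ring | rewrite b2 /e; ring].
have [M ME] : exists M, M = 1 - N by exists (1 - N).
rewrite -ME in N4; have eE : e ^+ 2 = M%:~R by rewrite ME intrB -bN bCE bE; ring.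
have [r [m [pE m_odd]]] : exists r m : nat, p = (2 ^ r.+1 * m).+1 /\ odd m.
  have p0 : (0 < p.-1)%N by lia.
  have [m cm pm] := pfactor_coprime (isT : prime 2) p0.
  have l2 : (1 <= logn 2 p.-1)%N.
    rewrite -pfactor_dvdn // expn1 dvdn2.
    by case: p op p1 p0 {cm pm} => [|p] //= op _ _; rewrite op.
  exists (logn 2 p.-1).-1, m; rewrite prednK // -coprime2n; split=> //.
  by rewrite mulnC -pm prednK // ltnW.
have [x [y [xo yo E]]] := pow2_expansion r m N4.
have T : b ^+ p + b^* ^+ p = (2 * (1 + 2 ^+ r * M * (x + 2 * y)))%:~R.
  rewrite pE !exprS bCE bE (E _ eE) E ?sqrrN // !(intrM, intrD, rmorphXn) /=.
  move: (2 ^+ r : algC) => P.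
  transitivity (2 * (1 + P * (M%:~R * x%:~R + 2 * y%:~R * e ^+ 2))); first by ring.
  by rewrite eE; ring.
move: N4 xo yo => /dvdzP[F FE] /dvdzP[u uE] /dvdzP[v vE].
have P0 : (2 ^+ r : int) != 0 by rewrite expf_neq0.
rewrite T; case=> h; [have {}h := @intr_inj algC _ 2 h | have {}h := @intr_inj algC _ (- 2) h].
  have /eqP : 2 ^+ r * M * (x + 2 * y) = 0 by lia.
  rewrite !mulf_eq0 (negPf P0) /= => /orP[/eqP|/eqP]; first by lia.
  by have := odd_double_half m; rewrite m_odd; lia.
have : (2 ^+ r * F * (x + 2 * y)) * 4 = - 2 by rewrite FE in h; lia.
lia.
Qed.

(** * The equation 4 y^3 = 1 + 3 c^2 *)

(** The root is g = gcd(a, c). Writing a = a' g and c = c' g gives a' b = g^(k-1) c'^k with a' prime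
    to c' and b prime to g, so a' = g^(k-1). *)
Lemma coprime_mul_expn k a b c : (0 < k)%N -> coprime a b -> (a * b = c ^ k)%N ->
  exists r : nat, a = (r ^ k)%N.
Proof.
case: k => // k _ cab E; case: (posnP a) => [->|a0]; first by exists 0%N; rewrite exp0n.
pose g := gcdn a c; have g0 : (0 < g)%N by rewrite gcdn_gt0 a0.
exists g; have [a' aE] := dvdnP (dvdn_gcdl a c); have [c' cE] := dvdnP (dvdn_gcdr a c).
rewrite -/g in aE cE.
have cop : coprime a' c'.
  by rewrite /coprime -(eqn_pmul2r g0) mul1n muln_gcdl -aE -cE.
have E' : (a' * b = g ^ k * c' ^ k.+1)%N.
  apply/eqP; rewrite -(eqn_pmul2r g0); apply/eqP.
  transitivity (a * b)%N; first by rewrite [in RHS]aE mulnAC.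
  by rewrite E {1}cE expnMn [(g ^ k.+1)%N]expnSr; lia.
have /eqP a'E : (a' == g ^ k)%N.
  rewrite eqn_dvd; apply/andP; split.
    by rewrite -(@Gauss_dvdl _ _ (c' ^ k.+1)) ?coprimeXr // -E' dvdn_mulr.
  rewrite -(@Gauss_dvdl _ _ b) ?E' ?dvdn_mulr // coprimeXl //.
  by apply: coprime_dvdl cab; exact: dvdn_gcdl.
by rewrite {1}aE a'E -expnSr.
Qed.

Lemma coprimez_mul_cube (a b c : int) : coprimez a b -> a * b = c ^+ 3 ->
  exists r : int, a = r ^+ 3.
Proof.
rewrite coprimezE => cab /(congr1 absz); rewrite abszM abszX => E.
have [r rE] := coprime_mul_expn (isT : 0 < 3)%N cab E.
have : a = r%:Z ^+ 3 \/ a = (- r%:Z) ^+ 3 by lia.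
by case=> ->; [exists r%:Z | exists (- r%:Z)].
Qed.

Lemma coprimez_mul_sqr (a b c : int) : 0 <= a -> coprimez a b -> a * b = c ^+ 2 ->
  exists r : int, a = r ^+ 2.
Proof.
rewrite coprimezE => a0 cab /(congr1 absz); rewrite abszM abszX => E.
have [r rE] := coprime_mul_expn (isT : 0 < 2)%N cab E.
by exists r%:Z; lia.
Qed.

(* The binary form with matrix (a, b; b, (b^2 + 3) / a) is reduced by descent on the odd
   number a, taking b even and smaller than a. *)
Lemma odd_dvd_sqr_add3 (a : nat) (b : int) : odd a -> (a %| b ^+ 2 + 3)%Z ->
  exists s t : int, a%:Z = s ^+ 2 + 3 * t ^+ 2 /\ (a %| s - b * t)%Z.
Proof.
elim/ltn_ind: a b => a IH b oa ab.
have [->|a1] := eqVneq a 1%N; first by exists 1, 0; split; rewrite ?dvd1z.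
have a3 : (2 < a)%N by case: a oa a1 {IH ab} => [|[|[|a]]].
have [b' [k [bE [b2 ltb]]]] : exists b' k : int,
    b = b' + a%:Z * k /\ ((2 %| b')%Z /\ `|b'| < a%:Z).
  have [q [r [E /andP[r0 ra]]]] : exists q r : int, b = q * a%:Z + r /\ (0 <= r < a%:Z).
    by exists (b %/ a)%Z, (b %% a)%Z; rewrite -divz_eq modz_ge0 ?ltz_pmod //; lia.
  case: (boolP (2 %| r)%Z) => r2; [exists r, q | exists (r - a%:Z), (q + 1)].
    by split; [rewrite E; ring | split; [|lia]].
  by split; [rewrite E; ring | split; lia].
have [c cE] : exists c : nat, b' ^+ 2 + 3 = a%:Z * c%:Z.
  have /dvdzP[c cE] : (a %| b' ^+ 2 + 3)%Z.
    have -> : b' ^+ 2 + 3 = (b ^+ 2 + 3) - a%:Z * (k * (b' + b)) by rewrite bE; ring.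
    by rewrite rpredB // dvdz_mulr.
  exists `|c|%N; rewrite cE mulrC gez0_abs //.
  rewrite -(pmulr_lge0 _ (_ : 0 < a%:Z)) -?cE; last by lia.
  by rewrite addr_ge0 ?sqr_ge0.
have /dvdzP[w wE] := b2.
have oc : odd c.
  have : odd `|b' ^+ 2 + 3| by rewrite wE; lia.
  by rewrite cE abszM /= oddM => /andP[].
(* As a >= 3, a c = b'^2 + 3 <= (a - 1)^2 + 3 < a^2. *)
have ca : (c < a)%N.
  rewrite ltnNge; apply/negP => ac.
  have : b' ^+ 2 <= (a%:Z - 1) ^+ 2.
    rewrite -subr_ge0; have -> : (a%:Z - 1) ^+ 2 - b' ^+ 2
      = (a%:Z - 1 - b') * (a%:Z - 1 + b') by ring.
    by apply: mulr_ge0; lia.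
  have : a%:Z * a%:Z <= a%:Z * c%:Z by rewrite ler_pM2l; lia.
  by rewrite -cE; lia.
have cdvd : (c %| (- b') ^+ 2 + 3)%Z by rewrite sqrrN cE dvdz_mull.
have [s [t [E /dvdzP[T TE]]]] := IH c ca (- b') oc cdvd.
(* These are the coordinates of (b' + sqrt(-3)) (s + t sqrt(-3)) / c. *)
exists (b' * T - a%:Z * t), T; split; last first.
  by apply/dvdzP; exists (- t - k * T); rewrite bE; ring.
have c0 : c%:Z != 0 by lia.
apply: (mulfI c0); apply: (mulfI c0).
have sE : s = T * c%:Z - b' * t by rewrite -TE; ring.
rewrite sE in E.
transitivity ((a%:Z * c%:Z) * c%:Z); first by ring.
transitivity ((a%:Z * c%:Z) * ((T * c%:Z - b' * t) ^+ 2 + 3 * t ^+ 2)); first by congr (_ * _).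
transitivity ((b' * T * c%:Z - (a%:Z * c%:Z) * t) ^+ 2 + 3 * (T * c%:Z) ^+ 2); last by ring.
rewrite -cE; ring.
Qed.

Lemma odd_add_half (a b : int) : ~~ (2 %| a)%Z -> ~~ (2 %| b)%Z -> exists q, a + b = 2 * q.
Proof. by exists ((a + b) %/ 2)%Z; lia. Qed.

Lemma sqr_add3_eq1 (x y : int) : x ^+ 2 + 3 * y ^+ 2 = 1 -> y = 0 /\ (x = 1 \/ x = -1).
Proof.
move=> E; have y0 : y = 0.
  apply/eqP; rewrite -sqrf_eq0; apply/eqP.
  by have := sqr_ge0 x; have := sqr_ge0 y; lia.
split=> //; move: E; rewrite y0 expr0n mulr0 addr0 => /eqP.
by rewrite sqrf_eq1 => /orP[]/eqP ->; [left | right].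
Qed.

Lemma coprimez_bezout (m n u v : int) : u * m + v * n = 1 -> coprimez m n.
Proof. by move=> E; apply/coprimezP; exists (u, v). Qed.

Lemma ndvd2_coprimez (m : int) : ~~ (2 %| m)%Z -> coprimez 2 m.
Proof. by move=> h; rewrite coprimezE prime_coprime. Qed.

(* With h = q / p mod r^3, r = s^2 + 3 t^2 and s = h t mod r, the product
   (q + p sqrt(-3)) (s - t sqrt(-3))^3 is divisible by r^3, with quotient a unit. *)
Lemma cube_sqr_add3 (q p r : int) : coprimez q p -> ~~ (2 %| r)%Z ->
  q ^+ 2 + 3 * p ^+ 2 = r ^+ 3 ->
  exists s t : int, q = s ^+ 3 - 9 * s * t ^+ 2 /\ p = 3 * s ^+ 2 * t - 3 * t ^+ 3.
Proof.
move=> cqp r_odd E.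
have r0 : 0 < r.
  have h : 0 <= r ^+ 3 by rewrite -E; have := sqr_ge0 q; have := sqr_ge0 p; lia.
  have : r != 0 by apply: contraNneq r_odd => ->.
  have : 0 <= r by rewrite -(@exprn_odd_ge0 _ 3).
  lia.
have cpr : coprimez p (r ^+ 3).
  have /coprimezP[[u v] /= uv] := (coprimezXl 2 cqp).
  apply: (@coprimez_bezout _ _ (v - 3 * u * p) u).
  by rewrite -E -[RHS]uv; ring.
have /coprimezP[[x y] /= xy] := cpr.
pose h := q * x; pose i := q * y.
have qE : q = h * p + r ^+ 3 * i by rewrite -[LHS]mulr1 -xy /h /i; ring.
have [k kE] : exists k, h ^+ 2 + 3 = k * r ^+ 3.
  apply/dvdzP; rewrite -(@Gauss_dvdzr _ (p ^+ 2)).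
    have -> : p ^+ 2 * (h ^+ 2 + 3)
      = r ^+ 3 * (1 - 2 * h * p * i - r ^+ 3 * i ^+ 2); last by rewrite dvdz_mulr.
    transitivity ((q ^+ 2 + 3 * p ^+ 2) - r ^+ 3 * (2 * h * p * i + r ^+ 3 * i ^+ 2)).
      by rewrite {1}qE; ring.
    by rewrite E; ring.
  by rewrite coprimez_sym coprimezXl.
have rE : r = `|r|%N%:Z by rewrite gez0_abs // ltW.
have [||s [t [stE st]]] := @odd_dvd_sqr_add3 `|r| h.
- by lia.
- by rewrite -rE kE !exprS mulrCA dvdz_mulr.
rewrite -rE in stE st; have /dvdzP[z zE] := st.
have sE : s = h * t + r * z by rewrite -[LHS](subrK (h * t)) zE; ring.
pose S := s ^+ 3 - 9 * s * t ^+ 2; pose T := 3 * s ^+ 2 * t - 3 * t ^+ 3.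
pose j := - 2 * h * t ^+ 3 * k - 3 * k * t ^+ 2 * r * z + z ^+ 3.
have ST : S - h * T = r ^+ 3 * j.
  transitivity (- 2 * h * t ^+ 3 * (h ^+ 2 + 3) - 3 * (h ^+ 2 + 3) * t ^+ 2 * r * z
                + r ^+ 3 * z ^+ 3); first by rewrite /S /T sE; ring.
  by rewrite kE /j; ring.
pose X := p * (h * j + k * T) + i * S; pose Y := p * j - i * T.
have XE : q * S + 3 * p * T = r ^+ 3 * X.
  transitivity (p * (h * (S - h * T) + (h ^+ 2 + 3) * T) + r ^+ 3 * i * S).
    by rewrite {1}qE; ring.
  by rewrite ST kE /X; ring.
have YE : p * S - q * T = r ^+ 3 * Y.
  transitivity (p * (S - h * T) - r ^+ 3 * i * T); first by rewrite {1}qE; ring.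
  by rewrite ST /Y; ring.
have STN : S ^+ 2 + 3 * T ^+ 2 = r ^+ 3 by rewrite stE /S /T; ring.
have R0 : r ^+ 3 != 0 by rewrite expf_neq0 // gt_eqF.
have XY : X ^+ 2 + 3 * Y ^+ 2 = 1.
  apply: (mulfI (mulf_neq0 R0 R0)); rewrite mulr1.
  transitivity ((q * S + 3 * p * T) ^+ 2 + 3 * (p * S - q * T) ^+ 2).
    by rewrite XE YE; ring.
  transitivity ((q ^+ 2 + 3 * p ^+ 2) * (S ^+ 2 + 3 * T ^+ 2)); first by ring.
  by rewrite E STN.
have [Y0 X1] := sqr_add3_eq1 XY.
have qX : q = X * S.
  apply: (mulfI R0); rewrite -[in LHS]STN.
  transitivity ((q * S + 3 * p * T) * S - 3 * (p * S - q * T) * T); first by ring.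
  by rewrite XE YE Y0; ring.
have pX : p = X * T.
  apply: (mulfI R0); rewrite -[in LHS]STN.
  transitivity ((q * S + 3 * p * T) * T + (p * S - q * T) * S); first by ring.
  by rewrite XE YE Y0; ring.
(* The unit -1 is a cube, absorbed by changing the signs of s and t. *)
case: X1 => X1; rewrite qX pX X1; [exists s, t | exists (- s), (- t)];
  by rewrite /S /T; split; ring.
Qed.

(** The factors 2 x, x - y and x + y are pairwise coprime, hence cubes B^3, C^3, D^3. With C = q - p
    and D = q + p, the relation C^3 + D^3 = 2 x = B^3 is an equation of the original shape. *)
Lemma cube_descent_step (x y A : int) : coprimez x y -> ~~ (2 %| x + y)%Z -> x != 0 ->
  2 * (x * (x - y) * (x + y)) = A ^+ 3 ->
  exists q p v : int, [/\ coprimez q p, ~~ (2 %| q + p)%Z, q != 0,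
    2 * q * (q ^+ 2 + 3 * p ^+ 2) = v ^+ 3 & v ^+ 3 = 2 * x].
Proof.
move=> cxy xy_odd x0 E.
have /coprimezP[[u w] /= uw] := cxy.
have xmy_odd : ~~ (2 %| x - y)%Z.
  have -> : x - y = x + y - 2 * y by ring.
  by rewrite rpredBr // dvdz_mulr.
have c2p := ndvd2_coprimez xy_odd; have c2m := ndvd2_coprimez xmy_odd.
have cxm : coprimez x (x - y).
  by apply: (@coprimez_bezout _ _ (u + w) (- w)); rewrite -[RHS]uw; ring.
have cxp : coprimez x (x + y).
  by apply: (@coprimez_bezout _ _ (u - w) w); rewrite -[RHS]uw; ring.
have cmp : coprimez (x - y) (x + y).
  have h : coprimez (x - y) (2 * y).
    rewrite coprimezMr coprimez_sym c2m /=.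
    by apply: (@coprimez_bezout _ _ u (u + w)); rewrite -[RHS]uw; ring.
  have /coprimezP[[a b] /= ab] := h.
  by apply: (@coprimez_bezout _ _ (a - b) b); rewrite -[RHS]ab; ring.
have [B BE] : exists B : int, 2 * x = B ^+ 3.
  apply: (@coprimez_mul_cube _ ((x - y) * (x + y)) A).
    by rewrite coprimezMl !coprimezMr c2m c2p cxm cxp.
  by rewrite -E; ring.
have [C CE] : exists C : int, x - y = C ^+ 3.
  apply: (@coprimez_mul_cube _ (2 * x * (x + y)) A); last by rewrite -E; ring.
  by rewrite !coprimezMr cmp andbT; apply/andP; split; rewrite coprimez_sym.
have [D DE] : exists D : int, x + y = D ^+ 3.
  apply: (@coprimez_mul_cube _ (2 * x * (x - y)) A); last by rewrite -E; ring.
  by rewrite !coprimezMr; apply/andP; split; [apply/andP; split|]; rewrite coprimez_sym.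
have C_odd : ~~ (2 %| C)%Z by apply: contra xmy_odd => h; rewrite CE dvdz_exp.
have D_odd : ~~ (2 %| D)%Z by apply: contra xy_odd => h; rewrite DE dvdz_exp.
have [q qE] := odd_add_half C_odd D_odd.
pose p := D - q.
have CE' : C = q - p by transitivity (2 * q - D); [rewrite -qE | rewrite /p]; ring.
have DE' : D = q + p by rewrite /p; ring.
have qpB : 2 * q * (q ^+ 2 + 3 * p ^+ 2) = B ^+ 3.
  transitivity (C ^+ 3 + D ^+ 3); first by rewrite CE' DE'; ring.
  by rewrite -CE -DE -BE; ring.
have cCD : coprimez C D.
  move: cmp; rewrite CE DE => /coprimezP[[a b] /= ab].
  by apply: (@coprimez_bezout _ _ (a * C ^+ 2) (b * D ^+ 2)); rewrite -[RHS]ab; ring.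
exists q, p, B; split; [| by rewrite -DE' | | by [] | by rewrite BE].
- move: cCD; rewrite CE' DE' => /coprimezP[[a b] /= ab].
  by apply: (@coprimez_bezout _ _ (a + b) (b - a)); rewrite -[RHS]ab; ring.
- apply: contra_neq x0 => q0; move: qpB; rewrite q0 mulr0 mul0r -BE => qpB.
  by apply: (@mulfI _ 2) => //; rewrite -qpB mulr0.
Qed.

Lemma sqr_add3_gt0 (a b : int) : a != 0 -> 0 < a ^+ 2 + 3 * b ^+ 2.
Proof.
move=> a0; have : 0 < a ^+ 2 by rewrite exprn_even_gt0 // a0.
by have := sqr_ge0 b; lia.
Qed.

Lemma norm_mul_gt1 (a b : int) : a != 0 -> 1 < b -> 1 < `|a * b|.
Proof.
move=> a0 b1; have b0 : 0 < b by exact: lt_trans b1.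
rewrite normrM (gtr0_norm b0); apply: lt_le_trans b1 _.
by apply: ler_peMl; [exact: ltW | rewrite -gtz0_ge1 normr_gt0].
Qed.

(** Infinite descent on |v|. If 3 does not divide q, then 2 q and q^2 + 3 p^2 are coprime, hence
    cubes; [cube_sqr_add3] gives q = s (s - 3 t) (s + 3 t), and [cube_descent_step] turns 2 q = A^3
    into a solution with cube 2 s. *)
Lemma euler_cubic_descent (q p v : int) : coprimez q p -> ~~ (2 %| q + p)%Z -> q != 0 ->
  2 * q * (q ^+ 2 + 3 * p ^+ 2) <> v ^+ 3.
Proof.
move: {2}`|v|.+1 (ltnSn `|v|) => n; elim: n => // n IH in q p v *.
rewrite ltnS => vn cqp odd_qp q0 E.
have next x y A : coprimez x y -> ~~ (2 %| x + y)%Z -> x != 0 ->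
    2 * (x * (x - y) * (x + y)) = A ^+ 3 -> `|2 * x| < `|v ^+ 3| -> False.
  move=> cxy xy_odd x0 EA lt.
  have [q' [p' [w [c' o' q0' E' wE]]]] := cube_descent_step cxy xy_odd x0 EA.
  apply: (IH q' p' w) => //; apply: leq_trans vn.
  move: lt; rewrite -wE !normrX -!abszE ltr_pXn2r ?nnegrE //.
have /coprimezP[[u w] /= uw] := cqp.
have N_odd a b : ~~ (2 %| a + b)%Z -> ~~ (2 %| a ^+ 2 + 3 * b ^+ 2)%Z.
  move=> ab; have -> : a ^+ 2 + 3 * b ^+ 2 = (a + b) ^+ 2 + 2 * (b ^+ 2 - a * b) by ring.
  by rewrite rpredDr; [rewrite (@dvdz_primeX 2) | exact: dvdz_mulr].
have N_pos := sqr_add3_gt0 p q0.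
(* If 3 divides q, then q = 3 k, k = 3 j, v = 3 v' and 2 j (p^2 + 3 k^2) = v'^3; now p and k play
   the roles of q and p, and the descent step is applied to t and s. *)
have [/dvdzP[k kE]|q3] := boolP (3 %| q)%Z.
  have p3 : ~~ (3 %| p)%Z.
    apply/negP => /dvdzP[p' p'E]; have : (3 %| 1)%Z.
      by apply/dvdzP; exists (u * k + w * p'); rewrite -[LHS]uw kE p'E; ring.
    by [].
  have cp3 : coprimez 3 p by rewrite coprimezE prime_coprime.
  have /dvdzP[v' v'E] : (3 %| v)%Z.
    rewrite -(@dvdz_primeX 3 _ _ 2) // -E kE; apply/dvdzP.
    by exists (2 * k * (q ^+ 2 + 3 * p ^+ 2)); rewrite kE; ring.
  have E3 : 2 * k * (3 * k ^+ 2 + p ^+ 2) = 3 * v' ^+ 3.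
    apply: (@mulfI _ 9) => //; transitivity (v ^+ 3); [rewrite -E kE | rewrite v'E]; ring.
  have /dvdzP[j jE] : (3 %| k)%Z.
    have h : (3 %| 2 * k * (3 * k ^+ 2 + p ^+ 2))%Z by rewrite E3 dvdz_mulr.
    have c : coprimez 3 (2 * (3 * k ^+ 2 + p ^+ 2)).
      rewrite coprimezMr; apply/andP; split => //.
      rewrite /coprimez mulrC gcdzMDl; exact: coprimezXr.
    by rewrite -(Gauss_dvdzl _ c); move: h; congr (_ %| _)%Z; ring.
  have E4 : 2 * j * (p ^+ 2 + 3 * k ^+ 2) = v' ^+ 3.
    by apply: (@mulfI _ 3) => //; rewrite -E3 jE; ring.
  have j0 : j != 0 by apply: contra_neq q0 => j0; rewrite kE jE j0.
  have cpk : coprimez p k.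
    by apply: (@coprimez_bezout _ _ w (3 * u)); rewrite -[RHS]uw kE; ring.
  have pk_odd : ~~ (2 %| p + k)%Z.
    apply: contra odd_qp => h; rewrite kE.
    have -> : k * 3 + p = (p + k) + 2 * k by ring.
    by apply: rpredD; [exact: h | exact: dvdz_mulr].
  have c2j : coprimez (2 * j) (p ^+ 2 + 3 * k ^+ 2).
    rewrite coprimezMl ndvd2_coprimez ?N_odd //=.
    have /coprimezP[[a b] /= ab] : coprimez j (p ^+ 2).
      apply: coprimezXr; apply: (@coprimez_bezout _ _ (9 * u) w).
      by rewrite -[RHS]uw kE jE; ring.
    apply: (@coprimez_bezout _ _ (a - 27 * b * j) b).
    by rewrite -[RHS]ab jE; ring.
  have [A AE] := coprimez_mul_cube c2j E4.
  have [r rE] : exists r, p ^+ 2 + 3 * k ^+ 2 = r ^+ 3.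
    by apply: (@coprimez_mul_cube _ (2 * j) v'); rewrite 1?coprimez_sym // mulrC.
  have r_odd : ~~ (2 %| r)%Z.
    by apply: contra (N_odd _ _ pk_odd) => h; rewrite rE dvdz_exp.
  have [s [t [pE kst]]] := cube_sqr_add3 cpk r_odd rE.
  have jst : j = t * (s - t) * (s + t).
    by apply: (@mulfI _ 3) => //; transitivity k; [rewrite jE | rewrite kst]; ring.
  apply: (@next t s (- A)).
  - have /coprimezP[[a b] /= ab] := cpk.
    apply: (@coprimez_bezout _ _ (b * (3 * s ^+ 2 - 3 * t ^+ 2) - 9 * a * s * t) (a * s ^+ 2)).
    by rewrite -[RHS]ab pE kst; ring.
  - apply: contra pk_odd => h; rewrite pE kst.
    have -> : s ^+ 3 - 9 * s * t ^+ 2 + (3 * s ^+ 2 * t - 3 * t ^+ 3)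
      = (t + s) * (s ^+ 2 + 2 * s * t - 11 * t ^+ 2) + 2 * (4 * t ^+ 3) by ring.
    by apply: rpredD; [apply: dvdz_mulr | apply: dvdz_mulr].
  - by apply: contra_neq j0 => t0; rewrite jst t0 !mul0r.
  - by rewrite exprNn -AE jst; ring.
  - have -> : v ^+ 3 = (2 * t) * ((s - t) * (s + t) * (27 * (p ^+ 2 + 3 * k ^+ 2))).
      by rewrite v'E exprMn -E4 jst; ring.
    have h1 : (s - t) * (s + t) != 0.
      by apply: contra_neq j0 => st; rewrite jst -mulrA st mulr0.
    have p0 : p != 0 by apply: contraNneq p3 => ->.
    have h2 : 1 < 27 * (p ^+ 2 + 3 * k ^+ 2).
      by move: (sqr_add3_gt0 k p0); clear; lia.
    have t0 : t != 0 by apply: contra_neq j0 => t0; rewrite jst t0 !mul0r.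
    by rewrite (normrM (2 * t)) ltr_pMr ?normr_gt0 ?mulf_neq0 // norm_mul_gt1.
have cq3 : coprimez 3 q by rewrite coprimezE prime_coprime.
have c2q : coprimez (2 * q) (q ^+ 2 + 3 * p ^+ 2).
  rewrite coprimezMl ndvd2_coprimez ?N_odd //=.
  have /coprimezP[[a b] /= ab] : coprimez q (3 * p ^+ 2).
    by rewrite coprimezMr coprimez_sym cq3 coprimezXr.
  by apply: (@coprimez_bezout _ _ (a - b * q) b); rewrite -[RHS]ab; ring.
have [A AE] := coprimez_mul_cube c2q E.
have [r rE] : exists r, q ^+ 2 + 3 * p ^+ 2 = r ^+ 3.
  by apply: (@coprimez_mul_cube _ (2 * q) v); rewrite 1?coprimez_sym // mulrC.
have r_odd : ~~ (2 %| r)%Z.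
  by apply: contra (N_odd _ _ odd_qp) => h; rewrite rE dvdz_exp.
have [s [t [qE pE]]] := cube_sqr_add3 cqp r_odd rE.
have s0 : s != 0.
  by apply: contra_neq q0 => s0; rewrite qE s0 expr0n /= mulr0 mul0r subr0.
have qst : q = s * (s - 3 * t) * (s + 3 * t) by rewrite qE; ring.
apply: (@next s (3 * t) A) => //.
- rewrite coprimezMr; apply/andP; split.
    rewrite coprimez_sym coprimezE prime_coprime //.
    by apply: contra q3 => h; rewrite qst -!mulrA; apply: dvdz_mulr.
  apply: (@coprimez_bezout _ _ (u * (s ^+ 2 - 9 * t ^+ 2) + 3 * w * s * t) (- 3 * w * t ^+ 2)).
  by rewrite -[RHS]uw qE pE; ring.
- apply: contra odd_qp => h; rewrite qE pE.
  have -> : s ^+ 3 - 9 * s * t ^+ 2 + (3 * s ^+ 2 * t - 3 * t ^+ 3)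
      = (s + 3 * t) * (s ^+ 2 - 9 * t ^+ 2) + 2 * (12 * t ^+ 3) by ring.
  by apply: rpredD; [apply: dvdz_mulr | apply: dvdz_mulr].
- by rewrite -AE qst; ring.
have h1 : (s - 3 * t) * (s + 3 * t) != 0.
  by apply: contra_neq q0 => st; rewrite qst -mulrA st mulr0.
(* Strict descent needs this: otherwise q = 1 or -1, and 2 q = A^3 is not a cube. *)
have N1 : q ^+ 2 + 3 * p ^+ 2 != 1.
  apply/eqP => /sqr_add3_eq1[_ q1].
  have A2 : (2 %| A)%Z by rewrite -(@dvdz_primeX 2 _ _ 2) // -AE dvdz_mulr.
  by have /dvdzP[A' A'E] := A2; move: AE; rewrite A'E; case: q1 => ->; clear; lia.
have -> : v ^+ 3 = (2 * s) * ((s - 3 * t) * (s + 3 * t) * (q ^+ 2 + 3 * p ^+ 2)).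
  by rewrite -E {1}qst; ring.
rewrite (normrM (2 * s)) ltr_pMr ?normr_gt0 ?mulf_neq0 // norm_mul_gt1 //.
by move: N_pos N1; clear; lia.
Qed.

(** Here c is odd, and c = 2 u - 1 gives y^3 = u^3 + (1 - u)^3. One of u and 1 - u is even; if it is
    u, then y = q + p and 1 - u = p - q give u^3 = 2 q (q^2 + 3 p^2). *)
Lemma four_cube_eq (y c : int) : 4 * y ^+ 3 = 1 + 3 * c ^+ 2 -> y = 1.
Proof.
have main u z : (2 %| u)%Z -> z ^+ 3 = 1 - 3 * u * (1 - u) -> z = 1.
  move=> /dvdzP[u' uE] zE.
  have z_odd : ~~ (2 %| z)%Z.
    apply/negP => /dvdzP[z' z'E]; move: zE; rewrite z'E uE; lia.
  have v_odd : ~~ (2 %| 1 - u)%Z by rewrite uE; lia.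
  have [p pE] := odd_add_half z_odd v_odd.
  pose q := z - p.
  have zqp : z = q + p by rewrite /q; ring.
  have vqp : 1 - u = p - q.
    by transitivity (2 * p - z); [rewrite -pE | rewrite /q]; ring.
  have [q0|q0] := eqVneq q 0.
    have u3 : u ^+ 3 = 0.
      transitivity (1 - 3 * u * (1 - u) - (1 - u) ^+ 3); first by ring.
      by rewrite -zE zqp vqp q0 add0r subr0 subrr.
    have u0 : u = 0 by move/eqP: u3; rewrite expf_eq0 => /eqP.
    by transitivity (1 - u); [rewrite zqp vqp q0 add0r subr0 | rewrite u0 subr0].
  exfalso; apply: (@euler_cubic_descent q p u) => //; last 1 first.
  - transitivity (z ^+ 3 - (1 - u) ^+ 3); first by rewrite zqp vqp; ring.
    by rewrite zE; ring.
  (* The combination is z^2 (q + p) + 3 u (p - q) = z^3 + 3 u (1 - u) = 1. *)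
  - apply: (@coprimez_bezout _ _ (z ^+ 2 - 3 * u) (z ^+ 2 + 3 * u)).
    transitivity (z ^+ 2 * (q + p) + 3 * u * (p - q)); first by ring.
    by rewrite -zqp -vqp -exprSr zE; ring.
  - by rewrite -zqp.
move=> E; have c_odd : ~~ (2 %| c)%Z.
  by apply/negP => /dvdzP[c' c'E]; move: E; rewrite c'E; clear; lia.
have [u cE] : exists u, c = 2 * u - 1.
  by have [u uE] := odd_add_half c_odd (isT : ~~ (2 %| 1)%Z); exists u; rewrite -uE; ring.
have E' : y ^+ 3 = 1 - 3 * u * (1 - u) by move: E; rewrite cE; clear; lia.
case: (boolP (2 %| u)%Z) => u2; first exact: main u2 E'.
by apply: (main (1 - u)); [move: u2; clear; lia | rewrite E'; ring].
Qed.

(** * Orders of the ideal classes *)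

Lemma quadratic_elt (d t u N : int) : d < 0 -> t ^+ 2 - u ^+ 2 * d = 4 * N ->
  exists al, [/\ OK d al, al + al^* = t%:~R & al * al^* = N%:~R].
Proof.
move=> d0 E; pose r := sqrtC d%:~R : algC.
pose al := (t%:~R + u%:~R * r) / 2.
have alQ : al = ratr (t%:~R / 2) + ratr (u%:~R / 2) * r.
  by rewrite !fmorph_div /= !ratr_int ratr_nat /al; field.
have alC : al^* = (t%:~R - u%:~R * r) / 2.
  by rewrite alQ /r conjC_Qsqrt // !fmorph_div /= !ratr_int ratr_nat; field.
have tr : al + al^* = t%:~R by rewrite alC /al; field.
have nm : al * al^* = N%:~R.
  rewrite alC; transitivity ((t%:~R ^+ 2 - u%:~R ^+ 2 * r ^+ 2) / 4 : algC).
    by rewrite /al; field.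
  have -> : t%:~R ^+ 2 - u%:~R ^+ 2 * r ^+ 2 = (4 * N)%:~R :> algC.
    by rewrite sqrtCK -E intrB intrM !rmorphXn.
  by rewrite intrM; field.
exists al; split => //; split; first by rewrite alQ; eexists; eexists.
by apply: (@Aint_quadratic _ t N); rewrite -tr -nm; ring.
Qed.

Lemma conj_coprime_elt (d t u : int) (l n : nat) : d < 0 -> ~~ (l %| t)%Z ->
  t ^+ 2 - u ^+ 2 * d = 4 * l%:Z ^+ n -> exists2 al, conj_coprime d l n al & al + al^* = t%:~R.
Proof.
move=> d0 lt /(quadratic_elt d0)[al [Oal tr nm]]; exists al => //; split=> //.
  by rewrite nm rmorphXn.
by exists t.
Qed.

Lemma trace_sqr (b : algC) (a N : int) : b + b^* = a%:~R -> b * b^* = N%:~R ->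
  b ^+ 2 + b^* ^+ 2 = (a ^+ 2 - 2 * N)%:~R.
Proof. by move=> ab bN; rewrite intrB intrM rmorphXn /= -ab -bN; ring. Qed.

Lemma trace_unit_mul (b al e : algC) (t : int) (p : nat) : e = 1 \/ e = -1 ->
  b ^+ p = e * al -> al + al^* = t%:~R ->
  b ^+ p + b^* ^+ p = t%:~R \/ b ^+ p + b^* ^+ p = (- t)%:~R.
Proof.
move=> e1 E tr; rewrite -rmorphXn /= E rmorphM /=.
case: e1 => ->; [left | right]; rewrite ?rmorphN rmorph1 /= -?tr ?intrN -?tr; ring.
Qed.

(** Only p = 2 survives, where Tr(b^2) = a^2 - 2 l^m. Of b only the norm is prescribed, so that b
    may be multiplied by a unit beforehand. *)
Lemma trace1_no_root (d : int) (l n p : nat) b al e : d < 0 -> (1 < l)%N -> (0 < n)%N ->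
  prime p -> (p %| n)%N -> OK d b -> b * b^* = l%:R ^+ (n %/ p) -> al + al^* = 1 ->
  e = 1 \/ e = -1 -> b ^+ p = e * al ->
  exists (m : nat) (a : int), n = (2 * m)%N /\
    (a ^+ 2 = 2 * l%:Z ^+ m + 1 \/ a ^+ 2 = 2 * l%:Z ^+ m - 1).
Proof.
move=> d0 l1 n0 p_pr pn Ob bN al1 e1 E.
have {bN}bN : b * b^* = (l%:Z ^+ (n %/ p))%:~R by rewrite bN rmorphXn.
have := @trace_unit_mul b al e 1 p e1 E al1; rewrite intrN => h.
have [p2|op] := even_prime p_pr; last first.
  case: (pow_trace_neq_unit d0 Ob p_pr op bN _ h).
  by rewrite exprn_egt1 // -lt0n divn_gt0 ?prime_gt0 // dvdn_leq.
subst p; have [a aE] := OK_trace d0 Ob.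
exists (n %/ 2)%N, a; split; first by rewrite mulnC divnK.
move: h; rewrite (trace_sqr aE bN).
case=> h; [left; have {}h := @intr_inj algC _ 1 h | right; have {}h := @intr_inj algC _ (-1) h].
  by apply: (addrI (- (2 * l%:Z ^+ (n %/ 2)))); rewrite addrC h; ring.
by apply: (addrI (- (2 * l%:Z ^+ (n %/ 2)))); rewrite addrC h; ring.
Qed.

Lemma odd_dvd_pow2 c k : odd c -> (c %| 2 ^ k)%N -> c = 1%N.
Proof.
rewrite -coprimen2 => /(coprimeXr k) /eqP cop /gcdn_idPl; by rewrite cop => ->.
Qed.

(** With |a| = 2 c + 1, c (c + 1) = 2^(m-1); the odd one of c and c + 1 divides a power of 2, so it
    is 1, whence c = 1. *)
Lemma sqr_pow2_add1 (a : int) m : (0 < m)%N -> a ^+ 2 = 2 * 2 ^+ m + 1 -> m = 2%N.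
Proof.
case: m => // m _ E.
have E' : (`|a| ^ 2 = 2 * 2 ^ m.+1 + 1)%N.
  have P : (2 ^ m.+1)%N%:Z = 2 ^+ m.+1 by rewrite -natz natrX.
  by rewrite -abszX E -P.
have [c cE] : exists c : nat, (`|a| = 2 * c + 1)%N.
  have ao : odd `|a|.
    by have := congr1 odd E'; rewrite oddX oddD oddM.
  by exists (`|a|./2); have := odd_double_half `|a|; rewrite ao; clear; lia.
have E1 : (c * c.+1 = 2 ^ m)%N.
  by move: E'; rewrite cE (expnS 2 m); move: (2 ^ m)%N; clear; lia.
have c1 : c = 1%N.
  case: (boolP (odd c)) => oc.
    by apply: (odd_dvd_pow2 oc (k := m)); rewrite -E1 dvdn_mulr.
  have : c.+1 = 1%N by apply: (@odd_dvd_pow2 _ m); rewrite // -E1 dvdn_mull.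
  by case=> c0; move: E1; rewrite c0 mul0n => /eqP; rewrite eq_sym expn_eq0.
by move: E1; rewrite c1; case: m {E E'} => [|[|m]] //; rewrite !expnS; lia.
Qed.

Lemma sqr_mod8 (c : int) :
  exists k : int, [\/ c ^+ 2 = 8 * k, c ^+ 2 = 8 * k + 1 | c ^+ 2 = 8 * k + 4].
Proof.
have [q [r [-> hr]]] : exists q r : int, c = 4 * q + r /\ [\/ r = 0, r = 1, r = 2 | r = 3].
  exists (c %/ 4)%Z, (c %% 4)%Z; split; first by lia.
  have : (0 <= c %% 4 < 4)%Z by rewrite modz_ge0 ?ltz_pmod.
  by case: (c %% 4)%Z => [[|[|[|[|r]]]]|] //= _;
    [apply: Or41 | apply: Or42 | apply: Or43 | apply: Or44].
case: hr => ->.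
- by exists (2 * q ^+ 2); apply: Or31; ring.
- by exists (2 * q ^+ 2 + q); apply: Or32; ring.
- by exists (2 * q ^+ 2 + 2 * q); apply: Or33; ring.
- by exists (2 * q ^+ 2 + 3 * q + 1); apply: Or32; ring.
Qed.

Lemma class_order_two (n : nat) : (0 < n)%N -> n <> 4%N ->
  splits_with_class_order (1 - 2%:Z ^+ (n + 2)) 2 n.
Proof.
move=> n0 n4; set d := 1 - _.
have X2 k : 0 < (2 : int) ^+ k by rewrite exprn_gt0.
have dE : d = 1 - 8 * 2 ^+ n.-1.
  by rewrite /d -[in LHS](prednK n0) addSn addn2 !exprS; ring.
have d0 : d < 0 by rewrite dE; have := X2 n.-1; lia.
have [al al_n al1] : exists2 al, conj_coprime d 2 n al & al + al^* = 1%:~R.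
  by apply: (@conj_coprime_elt d 1 1) => //; rewrite /d exprD; ring.
apply: (splits_of_no_root d0 _ n0 al_n) => // p b e p_pr pn [Ob bN _] Oe eN E.
(* As -d is 7 modulo 8, it is neither c^2 nor 3 c^2. *)
have e1 : e = 1 \/ e = -1.
  case: (norm1_cases d0 Oe eN); [by left | by right | |].
    case=> c cE; rewrite dE in cE; have [k ck] := sqr_mod8 c.
    by move: ck cE; move: (2 ^+ _) (c ^+ 2) => X c2; clear; case; lia.
  case=> [[c cE] _]; rewrite dE in cE; have [k ck] := sqr_mod8 c.
  by move: ck cE; move: (2 ^+ _) (c ^+ 2) => X c2; clear; case; lia.
have [m [a [nm aE]]] := trace1_no_root d0 (isT : 1 < 2)%N n0 p_pr pn Ob bN al1 e1 E.
have m0 : (0 < m)%N by lia.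
case: aE => aE; first by apply: n4; rewrite nm (sqr_pow2_add1 m0 aE).
(* For m > 0, 2 * 2^m - 1 is 3 modulo 4, hence no square. *)
have [k ak] := sqr_mod8 a; move: ak aE; rewrite -(prednK m0) [2 ^+ _]exprS.
by move: (2 ^+ _) (a ^+ 2) => X a2; clear; case; lia.
Qed.

(** Eliminating L, a^2 is 4 b^2 - 1 or 4 b^2 + 3, both 3 modulo 4, or it is 4 b^2 - 3 or 4 b^2 + 1,
    which lie strictly between consecutive squares when L > 1. *)
Lemma two_sqr_incompatible (L a b : int) : 1 < L ->
  a ^+ 2 = 2 * L + 1 \/ a ^+ 2 = 2 * L - 1 ->
  ~ (2 * b ^+ 2 = L + 1 \/ 2 * b ^+ 2 = L - 1).
Proof.
move=> L1; wlog a0 : a / 0 <= a.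
  move=> th; case: (lerP 0 a) => [|a0]; first exact: th.
  by rewrite -(sqrrN a); apply: th; lia.
wlog b0 : b / 0 <= b.
  move=> th; case: (lerP 0 b) => [|b0]; first exact: th.
  by rewrite -(sqrrN b); apply: th; lia.
have [k ak] := sqr_mod8 a.
case=> aE; case=> bE.
- by move: aE bE ak; move: (a ^+ 2) (b ^+ 2) => a2 b2; clear => aE bE; case; lia.
- by move: aE bE ak; move: (a ^+ 2) (b ^+ 2) => a2 b2; clear => aE bE; case; lia.
- have b2 : 2 <= b by move: L1 bE b0; clear; nia.
  have ab : a <= 2 * b - 1 by move: aE bE a0 b0; clear; nia.
  by move: ab aE bE a0 b2; clear; nia.
- have b1 : 1 <= b by move: L1 bE b0; clear; nia.
  have ab : 2 * b + 1 <= a by move: aE bE a0 b0; clear; nia.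
  by move: ab aE bE a0 b1; clear; nia.
Qed.

(** Of the coprime x and x + 1 one absorbs the factor 3, so the other is a square. *)
Lemma three_sqr_pronic (x c : int) : 0 < x -> x * (x + 1) = 3 * c ^+ 2 ->
  exists b : int, x + 1 = b ^+ 2 \/ x = b ^+ 2.
Proof.
move=> x0 E; have cop : coprimez x (x + 1).
  by apply: (@coprimez_bezout _ _ (-1) 1); ring.
have : (3 %| x * (x + 1))%Z by rewrite E dvdz_mulr.
rewrite (@dvdz_primeM 3) // => /orP[]/dvdzP[y yE].
  have [|||b bE] := @coprimez_mul_sqr (x + 1) y c.
  - by move: x0; clear; lia.
  - by move: cop; rewrite yE coprimezMl coprimez_sym => /andP[].
  - by apply: (@mulfI _ 3) => //; rewrite -E {2}yE; ring.
  by exists b; left.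
have [|||b bE] := @coprimez_mul_sqr x y c.
- exact: ltW.
- by move: cop; rewrite yE coprimezMr => /andP[].
- by apply: (@mulfI _ 3) => //; rewrite -E yE; ring.
by exists b; right.
Qed.

Lemma odd_prime_ndvd2 l : prime l -> odd l -> ~~ (l %| 2%:Z)%Z.
Proof.
by move=> l_pr ol; rewrite dvdzE /= dvdn_prime2 //; apply: contraL ol => /eqP ->.
Qed.

Lemma class_order_two_39 : splits_with_class_order (-39) 2 4.
Proof.
have d0 : (-39 : int) < 0 by [].
have [al al_n al5] : exists2 al, conj_coprime (-39) 2 4 al & al + al^* = 5%:~R.
  (* The element (5 + sqrt(-39)) / 2 has norm (25 + 39) / 4 = 2^4. *)
  exact: (@conj_coprime_elt (-39) 5 1).
apply: (splits_of_no_root d0 _ _ al_n) => // p b e p_pr pn [Ob bN _] Oe eN E.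
have e1 : e = 1 \/ e = -1.
  case: (norm1_cases d0 Oe eN); [by left | by right | |].
    case=> c cE; have [k ck] := sqr_mod8 c.
    by move: ck cE; move: (c ^+ 2) => c2; clear; case; lia.
  case=> [[c cE] _]; have [k ck] := sqr_mod8 c.
  by move: ck cE; move: (c ^+ 2) => c2; clear; case; lia.
have p2 : p = 2%N.
  have : (p %| 2 ^ 2)%N by [].
  by rewrite Euclid_dvdX // andbT dvdn_prime2 // => /eqP.
subst p; have [a aE] := OK_trace d0 Ob.
have [k ak] := sqr_mod8 a.
have bN' : b * b^* = 4%:~R by rewrite bN -natrX.
have := @trace_unit_mul b al e 5 2 e1 E al5.
rewrite (trace_sqr aE bN').
(* Here a^2 would be 8 + 5 or 8 - 5, that is 5 or 3 modulo 8. *)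
case=> h; [have {}h := @intr_inj algC _ 5 h | have {}h := @intr_inj algC _ (-5) h];
  by move: ak h; move: (a ^+ 2) => a2; clear; case; lia.
Qed.

(* When Q(sqrt d) = Q(sqrt (-3)) the unit e is a p-th power up to sign as p <> 3. *)
Lemma unit_root_absorb d p (b al e : algC) : prime p -> p <> 3%N ->
  OK d b -> OK d e -> e * e^* = 1 -> e ^+ 3 = 1 \/ e ^+ 3 = -1 -> b ^+ p = e * al ->
  exists b' e', [/\ OK d b', b' * b'^* = b * b^*, e' = 1 \/ e' = -1 & b' ^+ p = e' * al].
Proof.
move=> p_pr p3 Ob Oe eN e3 E.
(* Then (b e^k)^p = e^(p k + 1) al = e^(3 j) al, and e^3 is 1 or -1. *)
have [k [j jE]] : exists k j : nat, (p * k + 1 = 3 * j)%N.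
  have : (p %% 3 != 0)%N.
    by apply: contra_not_neq p3 => /eqP h; apply/esym/eqP; rewrite -dvdn_prime2.
  have := ltn_pmod p (isT : 0 < 3)%N; have := divn_eq p 3.
  case: (p %% 3)%N => [|[|[|r]]] // pE _ _.
    by exists 2%N, (2 * (p %/ 3) + 1)%N; lia.
  by exists 1%N, (p %/ 3 + 1)%N; lia.
exists (b * e ^+ k), (e ^+ (3 * j)); split.
- by auto.
- by rewrite rmorphM rmorphXn /= mulrACA -exprMn eN expr1n mulr1.
- rewrite exprM; case: e3 => ->; first by left; rewrite expr1n.
  by rewrite -signr_odd; case: (odd j); [right; rewrite expr1 | left; rewrite expr0].
- by rewrite exprMn E -exprM -jE exprD expr1 mulnC; ring.
Qed.

Lemma class_order_1m4 (l n : nat) : prime l -> odd l -> (0 < n)%N ->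
  (forall (m : nat) (a : int), n = (2 * m)%N ->
     ~ (a ^+ 2 = 2 * l%:Z ^+ m + 1 \/ a ^+ 2 = 2 * l%:Z ^+ m - 1)) ->
  splits_with_class_order (1 - 4 * l%:Z ^+ n) l n.
Proof.
move=> l_pr ol n0 no_sqr; set d := 1 - _.
have l1 := prime_gt1 l_pr.
have L1 : 1 < l%:Z ^+ n by rewrite exprn_egt1 // -lt0n.
have d0 : d < 0 by move: L1; rewrite /d; clear; lia.
have [al al_n al1] : exists2 al, conj_coprime d l n al & al + al^* = 1%:~R.
  apply: (@conj_coprime_elt d 1 1) => //; last by rewrite /d; ring.
  by rewrite dvdzE dvdn1 /= neq_ltn l1 orbT.
apply: (splits_of_no_root d0 l_pr n0 al_n) => p b e p_pr pn [Ob bN _] Oe eN E.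
have no b' e' : OK d b' -> b' * b'^* = l%:R ^+ (n %/ p) -> e' = 1 \/ e' = -1 ->
    b' ^+ p <> e' * al.
  move=> Ob' bN' e1 E'.
  have [m [a [nm aE]]] := trace1_no_root d0 l1 n0 p_pr pn Ob' bN' al1 e1 E'.
  exact: no_sqr nm aE.
case: (norm1_cases d0 Oe eN).
- by move=> e1; apply: (no b e) => //; left.
- by move=> e1; apply: (no b e) => //; right.
(* Q(i) is excluded: -d = 4 l^n - 1 is 3 modulo 4. *)
- case=> c cE; have [k ck] := sqr_mod8 c.
  by move: ck cE; rewrite /d; move: (c ^+ 2) (l%:Z ^+ n) => c2 L; clear; case; lia.
case=> [[c cE] e3].
(* For p = 3, y = l^(n/3) would satisfy 4 y^3 = 1 + 3 c^2, forcing y = 1. *)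
have p3 : p <> 3%N.
  move=> p3; subst p.
  have y1 : l%:Z ^+ (n %/ 3) = 1.
    apply: (@four_cube_eq _ c); rewrite -exprM divnK //.
    by rewrite -cE /d; ring.
  have : 1 < l%:Z ^+ (n %/ 3) by rewrite exprn_egt1 // -lt0n divn_gt0 // dvdn_leq.
  by rewrite y1.
have [b' [e' [Ob' bN' e1' E']]] := unit_root_absorb p_pr p3 Ob Oe eN e3 E.
by apply: (no b' e') => //; rewrite bN'.
Qed.

Lemma trace_oppX (b : algC) k : odd k ->
  (- b) ^+ k + (- b)^* ^+ k = - (b ^+ k + b^* ^+ k).
Proof.
move=> ok; rewrite rmorphN /= (exprNn b) (exprNn b^*) -signr_odd ok expr1; ring.
Qed.

(** The trace a of b divides 2. If a is 2 or -2, [trace2_pow_neq] applies up to sign; if a is 1 or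
    -1, Tr(b^p) = a^p modulo N, and values in {1, -1} and {2, -2} cannot agree modulo N > 3. *)
Lemma trace2_pow_neq_unit (d N : int) (p : nat) b : d < 0 -> OK d b -> odd p -> (1 < p)%N ->
  b * b^* = N%:~R -> (4 %| 1 - N)%Z -> 3 < N ->
  ~ (b ^+ p + b^* ^+ p = 2 \/ b ^+ p + b^* ^+ p = -2).
Proof.
move=> d0 Ob op p1 bN N4 N3 h.
have [a aE] := OK_trace d0 Ob; have [q qE] := trace_odd_pow_dvd d0 Ob aE op.
have h' : b ^+ p + b^* ^+ p = 2%:~R \/ b ^+ p + b^* ^+ p = (-2)%:~R by [].
have aq : a * q = 2 \/ a * q = -2.
  by case: h' => h'; [left | right]; apply: (@intr_inj algC); rewrite -qE h'.
have a_dvd : (`|a| %| 2)%N.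
  by apply/dvdnP; exists `|q|%N; rewrite mulnC -abszM; case: aq => ->.
have a12 : [\/ a = 1 \/ a = -1, a = 2 | a = -2].
  have le2 := dvdn_leq (isT : 0 < 2)%N a_dvd.
  have a0 : a != 0 by apply: contraTneq a_dvd => ->.
  have : [\/ a = 1, a = -1, a = 2 | a = -2].
    move: le2 a0; clear; case: a => [[|[|[|a]]]|[|[|a]]] //= _ _; 
      by [apply: Or41 | apply: Or42 | apply: Or43 | apply: Or44].
  by case=> ->; [apply: Or31; left | apply: Or31; right | apply: Or32 | apply: Or33].
have N1 : 1 < N by apply: lt_trans N3.
case: a12 => a12.
- have [f] := trace_pow d0 p.-1 Ob aE bN; rewrite (prednK (ltnW p1)) => fE.
  have ap : a ^+ p = 1 \/ a ^+ p = -1.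
    case: a12 => ->; first by left; rewrite expr1n.
    by right; rewrite -signr_odd op.
  have Nf : a ^+ p + N * f = 2 \/ a ^+ p + N * f = -2.
    by case: h' => h'; [left | right]; apply: (@intr_inj algC); rewrite -fE h'.
  have f0 : f != 0.
    by apply/eqP => f0; move: Nf ap; rewrite f0 mulr0 addr0; case=> ->; case.
  have {f0} : N <= `|N * f|.
    rewrite normrM (gtr0_norm (lt_trans ltr01 N1)); apply: ler_peMr.
      exact/ltW/(lt_trans ltr01).
    by rewrite -gtz0_ge1 normr_gt0.
  move: N3 ap Nf; move: (a ^+ p) (N * f) => x y; clear.
  by move=> N3 xE yE le; case: xE yE => ->; case; lia.
- by apply: (@trace2_pow_neq d N p b); rewrite // aE a12.
apply: (@trace2_pow_neq d N p (- b) d0 (OKN Ob) op p1 _ _ N4 N1).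
- by rewrite rmorphN /= -opprD aE a12 intrN opprK.
- by rewrite rmorphN /= mulrNN.
by rewrite trace_oppX //; case: h => ->; [right | left; rewrite opprK].
Qed.

Lemma class_order_1m_even (l m : nat) (a : int) : prime l -> odd l -> (0 < m)%N ->
  a ^+ 2 = 2 * l%:Z ^+ m + 1 \/ a ^+ 2 = 2 * l%:Z ^+ m - 1 ->
  splits_with_class_order (1 - l%:Z ^+ (2 * m)) l (2 * m).
Proof.
move=> l_pr ol m0 aE; set d := 1 - _.
have l1 := prime_gt1 l_pr.
have n0 : (0 < 2 * m)%N by rewrite muln_gt0.
pose L := l%:Z ^+ m; have dE : d = 1 - L ^+ 2 by rewrite /d /L -exprM mulnC.
have L1 : 1 < L by rewrite exprn_egt1 // -lt0n.
have d0 : d < 0 by move: L1; rewrite dE; clear; nia.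
have no_sqr := @two_sqr_incompatible L a _ L1 aE.
have [x xE] : exists x, L = 2 * x + 1.
  have : odd (l ^ m)%N by rewrite oddX ol orbT.
  have -> : L = (l ^ m)%N%:Z by rewrite -natz natrX natz.
  move: (l ^ m)%N => k ok; exists k./2%:Z.
  by rewrite -{1}(odd_double_half k) ok -muln2; lia.
have x0 : 0 < x by move: L1; rewrite xE; clear; lia.
have [al al_n al2] : exists2 al, conj_coprime d l (2 * m) al & al + al^* = 2%:~R.
  (* The element 1 + sqrt d has norm 1 - d = l^(2m). *)
  apply: (@conj_coprime_elt d 2 2) => //; last by rewrite /d; ring.
  exact: odd_prime_ndvd2.
apply: (splits_of_no_root d0 l_pr n0 al_n) => p b e p_pr pn [Ob bN _] Oe eN E.
have e1 : e = 1 \/ e = -1.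
  case: (norm1_cases d0 Oe eN); [by left | by right | |].
    (* L^2 - 1 lies strictly between (L - 1)^2 and L^2. *)
    case=> c; rewrite dE => cE; exfalso; move: L1 cE; clear => L1 cE.
    have : `|c| < L by nia.
    nia.
  (* With L = 2 x + 1 this reads 4 x (x + 1) = 3 c^2, so x or x + 1 is a square y^2, and 2 y^2 is L
     - 1 or L + 1. *)
  case=> [[c cE] _]; exfalso.
  have cE' : 4 * (x * (x + 1)) = 3 * c ^+ 2 by rewrite -cE dE xE; ring.
  have [c' c'E] : exists c', c = 2 * c'.
    have [k ck] := sqr_mod8 c.
    have c2 : (2 %| c)%Z.
      rewrite -(@dvdz_primeX 2 _ c 1) //; move: ck cE'.
      by move: (c ^+ 2) (x * _) => c2 y; clear; case; lia.
    by move/dvdzP: c2 => [c' ->]; exists c'; rewrite mulrC.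
  have E3 : x * (x + 1) = 3 * c' ^+ 2.
    by apply: (@mulfI _ 4) => //; rewrite cE' c'E; ring.
  have [y yE] := three_sqr_pronic x0 E3.
  by apply: (no_sqr y); case: yE => <-; [left | right]; rewrite xE; ring.
(* For p = 2, t^2 - 2 L is 2 or -2, so t = 2 s and 2 s^2 is L + 1 or L - 1. *)
have [p2|op] := even_prime p_pr.
  subst p; have [t tE] := OK_trace d0 Ob.
  have bN' : b * b^* = L%:~R by rewrite bN mulKn // rmorphXn.
  have : t ^+ 2 - 2 * L = 2 \/ t ^+ 2 - 2 * L = -2.
    have := @trace_unit_mul b al e 2 2 e1 E al2; rewrite (trace_sqr tE bN').
    by case=> h; [left; apply: (@intr_inj algC _ 2) | right; apply: (@intr_inj algC _ (-2))].
  have [k tk] := sqr_mod8 t.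
  move=> tL; have [s sE] : exists s, t = 2 * s.
    have t2 : (2 %| t)%Z.
      rewrite -(@dvdz_primeX 2 _ t 1) //; move: tk tL.
      by move: (t ^+ 2) (L) => t2 K; clear; case; lia.
    by move/dvdzP: t2 => [s ->]; exists s; rewrite mulrC.
  apply: (no_sqr s); move: tL; rewrite sE exprMn; move: (s ^+ 2) (L) => s2 K; clear; lia.
(* An odd p divides m, so the norm of b is the square of the odd s and is 1 modulo 4. *)
have pm : (p %| m)%N.
  move: pn; rewrite Euclid_dvdM // => /orP[|//].
  by rewrite dvdn_prime2 // => /eqP p2; rewrite p2 in op.
pose s := l%:Z ^+ (m %/ p).
have bN' : b * b^* = (s ^+ 2)%:~R.
  by rewrite bN -muln_divA // mulnC exprM [RHS]rmorphXn /= /s rmorphXn.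
have s1 : 1 < s by rewrite exprn_egt1 // -lt0n divn_gt0 ?prime_gt0 // dvdn_leq.
have N4 : (4 %| 1 - s ^+ 2)%Z.
  have so : ~~ (2 %| s)%Z.
    rewrite /s -(prednK (_ : 0 < m %/ p)%N) ?(@dvdz_primeX 2) //.
      by rewrite dvdzE /= dvdn2 negbK.
    by rewrite divn_gt0 ?prime_gt0 // dvdn_leq.
  have [k sk] := sqr_mod8 s.
  have s2 : ~~ (2 %| s ^+ 2)%Z by rewrite (@dvdz_primeX 2).
  by move: s2 sk; move: (s ^+ 2) => s2; clear => ?; case; lia.
have N3 : 3 < s ^+ 2 by move: s1; clear; nia.
exact: trace2_pow_neq_unit d0 Ob op (prime_gt1 p_pr) bN' N4 N3
  (@trace_unit_mul b al e 2 p e1 E al2).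
Qed.

Theorem theorem1p3 :
  (forall n : nat, (0 < n)%N -> n <> 4%N ->
     splits_with_class_order (1 - 2%:Z ^+ (n + 2)) 2 n)
  /\ splits_with_class_order (-39) 2 4
  /\ (forall (l n : nat), prime l -> odd l -> (0 < n)%N ->
        splits_with_class_order (1 - l%:Z ^+ n) l n
        \/ splits_with_class_order (1 - 4 * l%:Z ^+ n) l n).
Proof.
split; first exact: class_order_two.
split; first exact: class_order_two_39.
move=> l n l_pr ol n0.
pose L := (l ^ n./2)%N; have LE : L%:Z = l%:Z ^+ n./2 by rewrite -natz natrX natz.
(* A solution has a <= a^2 <= 2 L + 1, so the square condition is a finite boolean test; the minus
   sign is moved across to avoid truncated subtraction. *)
case: (boolP (~~ odd n && [exists a : 'I_(2 * L + 2),
    (a ^ 2 == 2 * L + 1)%N || (a ^ 2 + 1 == 2 * L)%N])).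
  move=> /andP[en /existsP[a aE]]; left.
  have nE : n = (2 * n./2)%N by rewrite mul2n even_halfK.
  rewrite [n in splits_with_class_order _ _ n]nE [n in l%:Z ^+ n]nE.
  apply: (@class_order_1m_even l n./2 a) => //.
    by rewrite half_gt0; case: n n0 en nE {L LE a aE} => [|[|n]].
  have aX : (a ^ 2)%N%:Z = a%:Z ^+ 2 by rewrite -natz natrX natz.
  by rewrite -LE -aX; case/orP: aE => /eqP h; [left; rewrite h | right]; move: h; clear; lia.
move=> no; right; apply: class_order_1m4 => // m a nm aE; move: no; rewrite nm oddM /=.
have hm : n./2 = m by rewrite nm mul2n doubleK.
move=> /negP; apply; apply/existsP.
have absE : (`|a| ^ 2 = 2 * L + 1 \/ `|a| ^ 2 + 1 = 2 * L)%N.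
  rewrite -abszX; move: LE; rewrite hm => LE; rewrite -LE in aE.
  by move: aE; move: (a ^+ 2) (L) => a2 K; clear; case=> ->; lia.
have lt : (`|a| < 2 * L + 2)%N.
  by move: absE; move: `|a|%N (L) => k K; clear; case; nia.
exists (Ordinal lt) => /=.
by case: absE => ->; rewrite eqxx ?orbT.
Qed.
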